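(* Let $\Gamma$ be a countable group acting faithfully and level transitively on a spherically symmetric rooted tree $\mathsf{T}_{\mathbf d}$ of bounded valency. Suppose: (i) $\Gamma$ is a just-infinite branch group (equivalently, $[\mathrm{Rist}_m^\Gamma(\mathsf{T}_{\mathbf d}),\mathrm{Rist}_m^\Gamma(\mathsf{T}_{\mathbf d})]$ is of finite index in $\Gamma$ for all $m\in\mathbb{N}$); (ii) there exists a sequence of subsets $\mathcal{N}_i\subseteq\mathrm{Aut}(\mathsf{T}_{s^i\mathbf d})$ such that (1) for every $g\in\Gamma$ there exists $n_g\in\mathbb{N}$ such that $g_v\in\mathcal{N}_{|v|}$ for all vertices $v$ of length at least $n_g$; and (2) there exist constants $c_0,i_0\in\mathbb{N}$ such that for any $i\ge i_0$ and any $\gamma\in\mathcal{N}_i\setminus\{id\}$, $\pi_{i,c_0}(\gamma)\ne id$, where $\pi_{i,c_0}:\mathrm{Aut}(\mathsf{T}_{s^i\mathbf d})\to\mathrm{Aut}(\mathsf{T}^{c_0}_{s^i\mathbf d})$ is the projection; (iii) any element $g\in\Gamma$ is of bounded activity, i.e. $\sup_{n\in\mathbb{N}}|\{v\in\mathsf{L}_n: g_v\ne id\}|<\infty$. Then all IRSs of $\Gamma$ are co-sofic.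
   Context: An IRS of a countable group $\Gamma$ is a Borel probability measure on $\mathrm{Sub}(\Gamma)\subset\{0,1\}^\Gamma$ (product topology) invariant under conjugation. An IRS is co-sofic if it is a weak-$*$ limit of IRSs supported on finite index subgroups. For a sequence $\mathbf{d}=(d_i)_{i\ge0}$ of integers $\ge2$, $\mathsf{T}_{\mathbf d}$ is the rooted tree of finite words in which every vertex at distance $i$ from the root has $d_i$ children; bounded valency means $\sup_i d_i<\infty$. $|v|$ is the length (level) of $v$, $\mathsf{L}_n$ the set of vertices of level $n$, $\mathsf{T}_{\mathbf d}^n$ the finite subtree of vertices up to level $n$. $s$ is the shift, $s\mathbf{d}=(d_{i+1})_{i\ge0}$; the subtree below any vertex of level $n$ is identified with $\mathsf{T}_{s^n\mathbf d}$. Automorphisms act on the right. For $g\in\mathrm{Aut}(\mathsf{T}_{\mathbf d})$ and a vertex $v$, the section $g_v\in\mathrm{Aut}(\mathsf{T}_{s^{|v|}\mathbf d})$ is defined by $(vw)\cdot g=(v\cdot g)(w\cdot g_v)$ for all words $w$. Level transitive: transitive on each $\mathsf{L}_n$. For a vertex $u$, $\mathrm{Rist}_\Gamma(u)$ is the subgroup of elements of $\Gamma$ acting trivially outside the subtree rooted at $u$; $\mathrm{Rist}_m^\Gamma(\mathsf{T}_{\mathbf d})=\prod_{u\in\mathsf{L}_m}\mathrm{Rist}_\Gamma(u)$. $\Gamma$ is a branch group if it acts level transitively, all $\mathrm{Rist}_\Gamma(u)$ are non-trivial, and $\mathrm{Rist}_m^\Gamma(\mathsf{T}_{\mathbf d})$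 has finite index in $\Gamma$ for all $m\in\mathbb{N}$. A group is just infinite if it is infinite and all of its proper quotients are finite. *)

(* Defs.v *)
From HB Require Import structures.
From mathcomp Require Import all_boot all_order all_algebra.
From mathcomp Require Import all_classical all_reals all_analysis.
Import numFieldNormedType.Exports.

Set Implicit Arguments.
Unset Strict Implicit.
Unset Printing Implicit Defensive.

Local Open Scope classical_set_scope.

Section RootedAut.
Variables (V : Type) (r : V) (childv : rel V).

Record rooted_aut := RootedAut {
  aut_fun :> V -> V;
  aut_bij : bijective aut_fun;
  aut_root : aut_fun r = r;
  aut_child : forall u v, childv (aut_fun u) (aut_fun v) = childv u v }.

Lemma rooted_autP (f g : rooted_aut) : f =1 g -> f = g.
Proof.
case: f g => [f f1 f2 f3] [g g1 g2 g3] /= /funext fg.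
by case: _ / fg in g1 g2 g3 *; congr RootedAut; exact: Prop_irrelevance.
Qed.

Definition aut_one : rooted_aut.
Proof. by exists id => //; exists id. Defined.

(* Automorphisms act on the right: f * g is f followed by g. *)
Definition aut_mul (f g : rooted_aut) : rooted_aut.
Proof.
exists (g \o f) => [||u v] /=.
- exact: bij_comp (aut_bij g) (aut_bij f).
- by rewrite !aut_root.
- by rewrite !aut_child.
Defined.

Lemma aut_has_inv (f : rooted_aut) :
  exists g : rooted_aut, cancel f g /\ cancel g f.
Proof.
have [g fK gK] := aut_bij f.
have gr : g r = r by rewrite -{1}(aut_root f) fK.
have gc u v : childv (g u) (g v) = childv u v.
  by rewrite -(aut_child f) !gK.
by exists (@RootedAut g (Bijective gK fK) gr gc).
Qed.

Definition aut_inv (f : rooted_aut) : rooted_aut :=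
  projT1 (cid (aut_has_inv f)).

HB.instance Definition _ := gen_eqMixin rooted_aut.
HB.instance Definition _ := gen_choiceMixin rooted_aut.

Fact aut_mulA : associative aut_mul.
Proof. by move=> f g h; apply: rooted_autP. Qed.
Fact aut_mul1 : left_id aut_one aut_mul.
Proof. by move=> f; apply: rooted_autP. Qed.
Fact aut_1mul : right_id aut_one aut_mul.
Proof. by move=> f; apply: rooted_autP. Qed.
Fact aut_mulV : left_inverse aut_one aut_inv aut_mul.
Proof.
move=> f; apply: rooted_autP => x /=; rewrite /aut_inv.
by case: cid => g [fK gK] /=; rewrite gK.
Qed.
Fact aut_Vmul : right_inverse aut_one aut_inv aut_mul.
Proof.
move=> f; apply: rooted_autP => x /=; rewrite /aut_inv.
by case: cid => g [fK gK] /=; rewrite fK.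
Qed.

HB.instance Definition _ := isGroup.Build rooted_aut
  aut_mulA aut_mul1 aut_1mul aut_mulV aut_Vmul.

End RootedAut.

Definition shiftd (d : nat -> nat) : nat -> nat := fun i => d i.+1.

Fixpoint is_word (d : nat -> nat) (w : seq nat) : bool :=
  if w is x :: w' then (x < d 0) && is_word (shiftd d) w' else true.

Definition vertex (d : nat -> nat) := {w : seq nat | is_word d w}.

Definition len d (v : vertex d) : nat := size (val v).

Definition rootv d : vertex d := exist (is_word d) [::] isT.

Definition childv d (u v : vertex d) : bool :=
  (len v == (len u).+1) && prefix (val u) (val v).

Definition Aut (d : nat -> nat) := rooted_aut (rootv d) (@childv d).

Lemma is_word_cat d v w :
  is_word d (v ++ w) = is_word d v && is_word (iter (size v) shiftd d) w.
Proof.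
elim: v d => //= x v IHv d.
by rewrite IHv andbA -iterS iterSr.
Qed.

Fixpoint words (d : nat -> nat) (n : nat) : seq (seq nat) :=
  if n is m.+1 then [seq x :: w | x <- iota 0 (d 0), w <- words (shiftd d) m]
  else [:: [::]].

Definition level d n : seq (vertex d) := pmap insub (words d n).

Lemma mem_words d n w : (w \in words d n) = is_word d w && (size w == n).
Proof.
elim: n d w => [|n IHn] d [|x w] //=.
- by rewrite andbF.
- by apply/negbTE/negP => /allpairsP[[a b] /= []].
apply/allpairsP/idP => [[[a b] /= []]|].
  rewrite mem_iota leq0n IHn add0n => /= ad /andP[wb sb] [-> ->].
  by rewrite eqSS ad wb.
rewrite eqSS -andbA => /and3P[xd ww sw].
by exists (x, w); rewrite /= mem_iota leq0n add0n IHn xd ww sw.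
Qed.

Lemma words_uniq d n : uniq (words d n).
Proof.
elim: n d => //= n IHn d; apply: allpairs_uniq => //; first exact: iota_uniq.
by move=> [a b] [a' b'] _ _ /= [-> ->].
Qed.

Lemma mem_level d n (v : vertex d) : (v \in level d n) = (len v == n).
Proof. by rewrite mem_pmap_sub mem_words (valP v). Qed.

Lemma level_uniq d n : uniq (level d n).
Proof. by apply: pmap_sub_uniq; exact: words_uniq. Qed.

Definition tvertex d n := {v : vertex d | len v <= n}.
Definition troot d n : tvertex d n :=
  exist (fun v : vertex d => len v <= n) (rootv d) (leq0n n).
Definition tchild d n (u v : tvertex d n) : bool := childv (val u) (val v).
Definition tAut d n := rooted_aut (troot d n) (@tchild d n).

Section AutTheory.
Variable d : nat -> nat.
Implicit Types (g : Aut d) (u v : vertex d).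

Lemma parent_exists v : v != rootv d ->
  exists2 t, childv t v & forall u, len u < len v ->
    prefix (val u) (val v) -> prefix (val u) (val t).
Proof.
case: v => w ww; case/lastP: w => [|w x] in ww *.
  by move=> /eqP[]; exact: val_inj.
have ww' : is_word d w by move: ww; rewrite -cats1 is_word_cat => /andP[].
move=> _; exists (exist (is_word d) w ww').
  by rewrite /childv /len /= size_rcons eqxx /= prefix_rcons.
move=> u; rewrite /len /= size_rcons ltnS => uw.
by rewrite -cats1 !prefixE takel_cat.
Qed.

Lemma aut_len g v : len (g v) = len v.
Proof.
have [n] := ubnP (len v); elim: n v => // n IHn v vn.
have [->|/parent_exists[u uv _]] := eqVneq v (rootv d); first by rewrite aut_root.
move: (uv); rewrite -(aut_child g) => /andP[/eqP -> _].
move: (uv) => /andP[/eqP e _].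
by rewrite e IHn//; move: vn; rewrite e.
Qed.

Lemma aut_prefix g u v :
  prefix (val u) (val v) -> prefix (val (g u)) (val (g v)).
Proof.
have [n] := ubnP (len v); elim: n v => // n IHn v vn uv.
have [lv|lv] := ltnP (len u) (len v); last first.
  suff -> : u = v by rewrite prefix_refl.
  apply: val_inj; apply/eqP; move: uv.
  by rewrite prefixE take_oversize // eq_sym.
have [e|/parent_exists[t tv /(_ u lv uv) ut]] := eqVneq v (rootv d).
  by move: lv; rewrite e.
move: (tv) => /andP[/eqP lt _].
move: (tv); rewrite -(aut_child g) => /andP[_]; apply: prefix_trans.
by apply: IHn ut; move: vn; rewrite lt.
Qed.

Lemma aut_fK g : cancel g (g^-1)%g.
Proof. by move=> v; rewrite -[RHS]/((1 : Aut d)%g v) -(mulgV g). Qed.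

Lemma aut_Kf g : cancel (g^-1)%g g.
Proof. by move=> v; rewrite -[RHS]/((1 : Aut d)%g v) -(mulVg g). Qed.

Section Concatenation.
Variable n : nat.

Lemma vcat_subproof v (ev : len v = n) (w : vertex (iter n shiftd d)) :
  is_word d (val v ++ val w).
Proof. by rewrite is_word_cat (valP v) [size _]ev (valP w). Qed.

Definition vcat v (ev : len v = n) (w : vertex (iter n shiftd d)) : vertex d :=
  exist (is_word d) _ (vcat_subproof ev w).

Lemma aut_vcat g v (ev : len v = n) (w : vertex (iter n shiftd d)) :
  val (g v) ++ drop n (val (g (vcat ev w))) = val (g (vcat ev w)).
Proof.
have /(@aut_prefix g) : prefix (val v) (val (vcat ev w)) by exact: prefix_prefix.
by move=> /prefixP[s ->]; rewrite drop_size_cat // [size _]aut_len.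
Qed.

Lemma sec_subproof g v (ev : len v = n) (w : vertex (iter n shiftd d)) :
  is_word (iter n shiftd d) (drop n (val (g (vcat ev w)))).
Proof.
have : is_word d (val (g v) ++ drop n (val (g (vcat ev w)))).
  by rewrite aut_vcat; exact: valP.
by rewrite is_word_cat [size _]aut_len ev => /andP[].
Qed.

Definition sec_fun g v (ev : len v = n) (w : vertex (iter n shiftd d)) :
  vertex (iter n shiftd d) := exist (is_word _) _ (sec_subproof g ev w).

Lemma sec_funE g v (ev : len v = n) (egv : len (g v) = n) w :
  g (vcat ev w) = vcat egv (sec_fun g ev w).
Proof. by apply: val_inj; rewrite /= aut_vcat. Qed.

Lemma vcat_inj v (ev : len v = n) : injective (vcat ev).
Proof.
move=> w w' /(congr1 val)/eqP /=; rewrite eqseq_cat // eqxx /= => /eqP.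
exact: val_inj.
Qed.

Lemma child_vcat v (ev : len v = n) w w' :
  childv (vcat ev w) (vcat ev w') = childv w w'.
Proof.
by rewrite /childv /len /= !size_cat -addnS eqn_add2l prefix_catr // eqxx.
Qed.

End Concatenation.

(* [autsec g v] is the section g_v, characterised by [autsecE]. *)
Definition autsec g v : Aut (iter (len v) shiftd d).
Proof.
exists (sec_fun g (erefl (len v))) => [||w w'].
- exists (sec_fun g^-1%g (aut_len g v)) => w.
    have e : len (g^-1%g (g v)) = len v by rewrite aut_fK.
    apply: (@vcat_inj _ _ e); rewrite -sec_funE -sec_funE aut_fK.
    by apply: val_inj; rewrite /= aut_fK.
  have e : len (g (g^-1%g (g v))) = len v by rewrite aut_Kf aut_len.
  have e' : len (g^-1%g (g v)) = len v by rewrite aut_fK.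
  apply: (@vcat_inj _ _ (aut_len g v)); rewrite -sec_funE.
  have -> : vcat (erefl (len v)) (sec_fun g^-1%g (aut_len g v) w) =
      vcat e' (sec_fun g^-1%g (aut_len g v) w).
    by apply: val_inj; rewrite /= aut_fK.
  by rewrite -sec_funE aut_Kf.
- apply: (@vcat_inj _ _ (aut_len g v)); rewrite -sec_funE.
  have -> u (eu : len u = len v) : vcat eu (rootv (iter (len v) shiftd d)) = u.
    by apply: val_inj; rewrite /= cats0.
  by apply: val_inj; rewrite /= cats0.
- by rewrite -(child_vcat (aut_len g v)) -!sec_funE aut_child child_vcat.
Defined.

Lemma autsecE g v (w : vertex (iter (len v) shiftd d)) :
  val (g (vcat (erefl (len v)) w)) = val (g v) ++ val (autsec g v w).
Proof. by rewrite (sec_funE _ (aut_len g v)). Qed.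

Lemma trunc_subproof n g (v : tvertex d n) : len (g (val v)) <= n.
Proof. by rewrite aut_len (valP v). Qed.

(* The restriction homomorphism from Aut(T_d) to Aut(T_d^n). *)
Definition trunc n g : tAut d n.
Proof.
pose f h (v : tvertex d n) : tvertex d n :=
  exist (fun u => len u <= n) _ (trunc_subproof h v).
exists (f g) => [||u v].
- by exists (f g^-1%g) => v; apply: val_inj; rewrite /= ?aut_fK ?aut_Kf.
- by apply: val_inj; rewrite /= aut_root.
- exact: aut_child.
Defined.

End AutTheory.

Section SubgroupSpace.
Variable G : groupType.
Local Open Scope group_scope.

Definition subgroups : set {ptws G -> bool} :=
  [set H | group_closed (H : {pred G})].

Definition Subgroup := set_type subgroups.

HB.instance Definition _ := Topological.copy Subgroup (set_type subgroups).

Definition sub_set (H : Subgroup) : set G := [set x | (val H : G -> bool) x].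

Fact trivial_subproof : ((fun x => x == 1) : {ptws G -> bool}) \in subgroups.
Proof.
apply/mem_set; split=> [|x y]; rewrite !unfold_in //.
by move=> /eqP-> /eqP->; rewrite divg1.
Qed.

Definition trivial_sub : Subgroup :=
  exist (fun H => H \in subgroups) _ trivial_subproof.

HB.instance Definition _ := isPointed.Build Subgroup trivial_sub.

Fact conj_subproof (H : Subgroup) (g : G) :
  ((fun x => (val H : G -> bool) (x ^ g^-1)) : {ptws G -> bool}) \in subgroups.
Proof.
apply/mem_set; have [H1 HF] := set_mem (valP H).
split=> [|x y]; rewrite !unfold_in; first by rewrite conj1g.
by rewrite conjMg conjVg; exact: HF.
Qed.

(* H^g = g^-1 H g, which contains x iff g x g^-1 lies in H. *)
Definition conj_sub (H : Subgroup) (g : G) : Subgroup :=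
  exist (fun K => K \in subgroups) _ (conj_subproof H g).

Definition is_normal (H : Subgroup) : Prop := forall g, conj_sub H g = H.

Definition left_coset (x : G) (H : set G) : set G := [set x * h | h in H].

Definition finite_index (H : set G) : Prop :=
  finite_set [set left_coset x H | x in [set: G]].

Definition just_infinite : Prop :=
  infinite_set [set: G] /\
  forall N : Subgroup, is_normal N -> N <> trivial_sub ->
    finite_index (sub_set N).

Definition BorelSub := g_sigma_algebraType (@open Subgroup).

Variable R : realType.

Definition is_IRS (mu : probability BorelSub R) : Prop :=
  forall (g : G) (A : set BorelSub), measurable A ->
    mu [set H | A (conj_sub H g)] = mu A.

Definition supported_on_finite_index (mu : probability BorelSub R) : Prop :=
  {ae mu, forall H : BorelSub, finite_index (sub_set H)}.

Definition weak_star_cvg (nu : nat -> probability BorelSub R)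
    (mu : probability BorelSub R) : Prop :=
  forall f : Subgroup -> R, continuous f ->
    (fun n => \int[nu n]_(H in [set: BorelSub]) f H)%R @ \oo -->
      (\int[mu]_(H in [set: BorelSub]) f H)%R.

Definition co_sofic (mu : probability BorelSub R) : Prop :=
  exists nu : nat -> probability BorelSub R,
    (forall n, is_IRS (nu n) /\ supported_on_finite_index (nu n)) /\
    weak_star_cvg nu mu.

End SubgroupSpace.

(* A homomorphism rho : G -> Aut d is a (right) action of G on the tree. *)
Section Action.
Variables (G : groupType) (d : nat -> nat).
Variable rho : {multiplicative G -> Aut d}.
Local Open Scope group_scope.

Definition level_transitive : Prop :=
  forall u v : vertex d, len u = len v -> exists g, rho g u = v.

Definition Rist (u : vertex d) : set G :=
  [set g | forall v, ~~ prefix (val u) (val v) -> rho g v = v].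

(* Rigid stabilizers of distinct vertices of the same level commute when rho is
   injective, so the order of the factors is then immaterial. *)
Definition Rist_level (m : nat) : set G :=
  [set \prod_(u <- level d m) f u | f in
     [set f : vertex d -> G | forall u, len u = m -> Rist u (f u)]].

Definition is_branch : Prop :=
  [/\ level_transitive,
      forall u, Rist u <> [set 1] &
      forall m, finite_index (Rist_level m)].

Definition bounded_activity (g : G) : Prop :=
  exists C : nat, forall n,
    size [seq v <- level d n | autsec (rho g) v != 1] <= C.

End Action.

(* Main.v *)
From HB Require Import structures.
Require Import Defs.
From mathcomp Require Import all_boot all_order all_algebra.
From mathcomp Require Import all_classical all_reals all_analysis.
From mathcomp Require Import measurable_realfun.

Set Implicit Arguments.
Unset Strict Implicit.
Unset Printing Implicit Defensive.
Import Order.TTheory GRing.Theory Num.Theory numFieldNormedType.Exports.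

(* Let [H] be an IRS, and call a vertex [v] thin when [H] does not contain a
   finite index subgroup of [Rist v].

   Almost surely [H] fixes all thin vertices.  If [gamma] in [H] moves [u], the
   set of [g] in [Rist u] with [gamma ^ g] in [H] is stationary under
   translation and lies in a single coset of a [Rist u]-invariant random
   subgroup, which must then have finite index; so the elements of [H]
   supported on [u] and [u gamma] induce a finite index subgroup of [Rist u].
   Using two elements of [H] that move a vertex to two different places and
   taking commutators, [H] contains the derived subgroup of a finite index
   subgroup of the rigid stabilizers below [u], and this has finite index in
   them because the group is just infinite.

   The n-th approximant of [H] consists of the elements that act like some
   element of [H] outside the thin vertices of level [n], where that element is
   trivial on the subtrees at the thin vertices, and on these subtrees are
   arbitrary except that they fix the levels up to [n + c0].  It has finite
   index and depends equivariantly on [H].  By contraction, an element of the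
   approximant lies in [H] as soon as [n] is large.  Conversely, if [g] in [H]
   is not in the approximant, then some thin [v] of level [n] with non-trivial
   section has a vertex [w] at most [c0] levels below it that is moved by [g],
   hence is not thin.  The probability of this is the drop of the probability
   of being thin between the levels of [v] and [w], which tends to [0], and by
   bounded activity the number of such [v] is bounded. *)

(** * Finite index *)

Section VirtualContainment.
Variable G : groupType.
Local Open Scope classical_set_scope.
Local Open Scope group_scope.
Implicit Types (A B H K : set G) (x y g : G).

(** The difference [x^-1 * y] is the one that detects left cosets, in agreement with [left_coset];
    [group_closed] uses the other side. *)
Definition is_subgroup H := H 1 /\ forall x y, H x -> H y -> H (x^-1 * y).

Lemma subgroupV H x : is_subgroup H -> H x -> H x^-1.
Proof. by move=> [H1 HD] Hx; rewrite -[x^-1]mulg1; exact: HD. Qed.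

Lemma subgroupM H x y : is_subgroup H -> H x -> H y -> H (x * y).
Proof.
move=> sH Hx Hy; rewrite -[x]invgK; apply: sH.2 => //.
exact: subgroupV.
Qed.

Lemma is_subgroupI H K : is_subgroup H -> is_subgroup K -> is_subgroup (H `&` K).
Proof.
move=> [H1 HD] [K1 KD]; split=> // x y [Hx Kx] [Hy Ky].
by split; [exact: HD | exact: KD].
Qed.

(* For a subgroup [H] and a subgroup [A], this says that [H `&` A] has finite
   index in [A]. *)
Definition virtually_contains H A :=
  exists s : seq G, forall a, A a -> exists2 x, x \in s & H (x^-1 * a).

(** Colours are easier to combine than representatives: for an intersection or a product of
    commuting factors one simply takes pairs of colours. *)
Lemma virtually_containsP H A : is_subgroup H -> virtually_contains H A <->
  exists (T : finType) (c : G -> T),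
    forall a b, A a -> A b -> c a = c b -> H (a^-1 * b).
Proof.
move=> sH; split=> [[s Hs]|[T [c Hc]]].
  pose i a := find (fun x => `[< H (x^-1 * a) >]) s.
  (* The colour of [a] is the position of its representative in [s]; the additional value is the one
     [find] returns when there is none. *)
  exists 'I_(size s).+1, (fun a => inord (i a)) => a b Aa Ab eab.
  have lts z : A z -> i z < size s.
    by move=> /Hs[x xs Hx]; rewrite -has_find; apply/hasP; exists x => //; exact/asboolP.
  have {eab} : i a = i b.
    by move/(congr1 val): eab; rewrite /= !inordK // ltnS ltnW // lts.
  have Hi z : A z -> H ((nth 1 s (i z))^-1 * z).
    by move=> /lts; rewrite -has_find => /(nth_find 1) /asboolP.
  move=> eab; have := sH.2 _ _ (Hi _ Aa) (Hi _ Ab).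
  by rewrite eab invgM invgK -mulgA mulVKg.
pose r t := if pselect (exists2 a, A a & c a = t) is left e then projT1 (cid2 e) else 1.
exists [seq r t | t <- enum T] => a Aa; exists (r (c a)).
  by apply: map_f; rewrite mem_enum.
rewrite /r; case: pselect => [e|]; last by case; exists a.
by case: cid2 => b /= Ab ?; exact: Hc.
Qed.

Lemma virtually_contains_sub H K A B : H `<=` K -> B `<=` A ->
  virtually_contains H A -> virtually_contains K B.
Proof.
move=> HK BA [s Hs]; exists s => b /BA /Hs[x xs Hx].
by exists x => //; exact: HK.
Qed.

Lemma virtually_contains_refl H : is_subgroup H -> virtually_contains H H.
Proof.
by move=> _; exists [:: 1] => a Ha; exists 1; rewrite ?inE // invg1 mul1g.
Qed.

Lemma virtually_containsI H K A : is_subgroup H -> is_subgroup K ->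
  virtually_contains H A -> virtually_contains K A ->
  virtually_contains (H `&` K) A.
Proof.
move=> sH sK /virtually_containsP-/(_ sH)[T [c Hc]].
move=> /virtually_containsP-/(_ sK)[T' [c' Kc]].
apply/virtually_containsP; first exact: is_subgroupI.
exists (T * T')%type, (fun a => (c a, c' a)) => a b Aa Ab [e e'].
by split; [exact: Hc | exact: Kc].
Qed.

Lemma virtually_containsIr H A : is_subgroup H -> is_subgroup A ->
  virtually_contains H A -> virtually_contains (H `&` A) A.
Proof.
move=> sH sA vH; apply: virtually_containsI => //.
exact: virtually_contains_refl.
Qed.

(** [H] is a set containing 1, so that the lemma applies directly to [Rist_level]. *)
Lemma finite_index_virtually H : H 1 -> finite_index H ->
  virtually_contains H [set: G].
Proof.
move=> H1 /finite_seqP[s Hs].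
pose r (C : set G) := if pselect (exists x, C = left_coset x H) is left e
  then projT1 (cid e) else 1.
exists [seq r C | C <- s] => a _.
exists (r (left_coset a H)).
  apply: map_f; have : [set left_coset x H | x in [set: G]] (left_coset a H).
    by exists a.
  by rewrite Hs.
rewrite /r; case: pselect => [e|]; last by case; exists a.
case: cid => b /= eb.
have : left_coset a H a by exists 1 => //; rewrite mulg1.
by rewrite eb => -[h Hh <-]; rewrite mulKg.
Qed.

Lemma virtually_finite_index H : is_subgroup H ->
  virtually_contains H [set: G] -> finite_index H.
Proof.
move=> sH [s Hs].
apply: (@sub_finite_set _ _ [set left_coset x H | x in [set` s]]); last first.
  by apply: finite_image; exact: finite_seq.
move=> _ [a _ <-]; have [//|x xs Hx] := Hs a.
exists x => //; apply/seteqP; split=> _ [h Hh <-].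
  exists ((x^-1 * a)^-1 * h); first exact: sH.2.
  by rewrite invgM invgK -mulgA mulVKg.
exists (x^-1 * a * h); first exact: subgroupM.
by rewrite -mulgA mulVKg.
Qed.

Lemma virtually_contains_conj H A x : is_subgroup H ->
  virtually_contains H A ->
  virtually_contains [set g | H (g ^ x)] [set g | A (g ^ x)].
Proof.
move=> sH [s Hs]; exists [seq y ^ x^-1 | y <- s] => a /= /Hs[y ys Hy].
exists (y ^ x^-1); first exact: map_f.
by rewrite conjMg conjVg conjgKV.
Qed.

(** It is enough to intersect the conjugates by the finitely many representatives in [s]: any [y] is
    [x * (x^-1 * y)] with [x] in [s], and conjugation by the second factor, an element of [H],
    preserves [H]. *)
Lemma virtually_contains_core H : is_subgroup H ->
  virtually_contains H [set: G] ->
  virtually_contains [set g | forall x, H (g ^ x)] [set: G].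
Proof.
move=> sH [s Hs].
have sK (t : seq G) : is_subgroup [set g | forall x, x \in t -> H (g ^ x)].
  split=> /= [x _|a b Ha Hb x xt]; first by rewrite conj1g; exact: sH.1.
  by rewrite conjMg conjVg; apply: sH.2; [exact: Ha|exact: Hb].
suff vK (t : seq G) :
    virtually_contains [set g | forall x, x \in t -> H (g ^ x)] [set: G].
  apply: (virtually_contains_sub _ _ (vK s)) => //= g Hg y.
  have [//|x xs Hy] := Hs y.
  rewrite -(mulVKg x y) conjgM; have Hgx := Hg _ xs.
  by apply: subgroupM => //; [exact: subgroupV|exact: subgroupM].
elim: t => [|x t IHt].
  by exists [:: 1] => a _; exists 1; rewrite ?inE.
have sx : is_subgroup [set g | H (g ^ x)].
  split=> /= [|a b]; first by rewrite conj1g; exact: sH.1.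
  by rewrite conjMg conjVg; exact: sH.2.
apply: (@virtually_contains_sub ([set g | H (g ^ x)] `&`
    [set g | forall y, y \in t -> H (g ^ y)]) _ [set: G]) => //.
  by move=> g [Hx Ht] y; rewrite inE => /orP[/eqP->|/Ht].
apply: virtually_containsI => //.
by apply: (virtually_contains_sub _ _ (virtually_contains_conj x sH (ex_intro _ s Hs))).
Qed.

Lemma virtually_contains_trans A H B : virtually_contains H A ->
  virtually_contains A B -> virtually_contains H B.
Proof.
move=> [s Hs] [t At]; exists [seq x * y | x <- t, y <- s] => b /At[x xt].
move=> /Hs[y ys Hy]; exists (x * y); first exact: allpairs_f.
by rewrite invgM -mulgA.
Qed.

Lemma invgM_commute (a b x y : G) : commute (a^-1 * b) x ->
  (a * x)^-1 * (b * y) = (a^-1 * b) * (x^-1 * y).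
Proof. by move=> /commuteV e; rewrite [RHS]mulgA e invgM !mulgA. Qed.

(** Commutation gives [(a * x)^-1 * (b * y) = (a^-1 * b) * (x^-1 * y)], so the colours of the two
    factors of a chosen factorisation colour the product. *)
Lemma virtually_containsM K A B : is_subgroup K ->
  (forall a b x, A a -> A b -> B x -> commute (a^-1 * b) x) ->
  virtually_contains K A -> virtually_contains K B ->
  virtually_contains K [set a * b | a in A & b in B].
Proof.
move=> sK cAB /virtually_containsP-/(_ sK)[T [c Kc]].
move=> /virtually_containsP-/(_ sK)[T' [c' Kc']].
apply/virtually_containsP => //.
have /choice[p Hp] (g : G) : exists p : G * G,
    [set a * b | a in A & b in B] g -> [/\ A p.1, B p.2 & p.1 * p.2 = g].
  have [[a Aa [b Bb <-]]|ng] := pselect ([set a * b | a in A & b in B] g).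
    by exists (a, b).
  by exists (1, 1).
exists (T * T')%type, (fun g => (c (p g).1, c' (p g).2)) => g h.
move=> /Hp[Ag Bg eg] /Hp[Ah Bh eh] [/(Kc _ _ Ag Ah) K1 /(Kc' _ _ Bg Bh) K2].
have -> : g^-1 * h = ((p g).1^-1 * (p h).1) * ((p g).2^-1 * (p h).2).
  by rewrite -invgM_commute ?eg ?eh //; exact: cAB.
exact: subgroupM.
Qed.

Lemma subgroup_of_proof H : is_subgroup H ->
  ((fun x => `[< H x >]) : {ptws G -> bool}) \in @subgroups G.
Proof.
move=> sH; apply/mem_set; split=> [|x y]; rewrite !unfold_in.
  by apply/asboolP; exact: sH.1.
move=> /asboolP Hx /asboolP Hy; apply/asboolP.
by apply: subgroupM => //; exact: subgroupV.
Qed.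

Definition subgroup_of H (sH : is_subgroup H) : Subgroup G :=
  exist (fun S => S \in @subgroups G) _ (subgroup_of_proof sH).

Lemma sub_set_of H (sH : is_subgroup H) : sub_set (subgroup_of sH) = H.
Proof. by apply/seteqP; split=> x /asboolP. Qed.

Lemma sub_set_inj : injective (@sub_set G).
Proof.
move=> H K /seteqP[HK KH]; apply: val_inj; apply/funext => x.
by apply/idP/idP; [exact: HK|exact: KH].
Qed.

Lemma sub_set_subgroup (H : Subgroup G) : is_subgroup (sub_set H).
Proof.
have [H1 HD] := set_mem (valP H); split=> // x y Hx Hy.
have HV z : sub_set H z -> sub_set H z^-1.
  by move=> Hz; rewrite -[z^-1]mul1g; exact: HD.
by have := HD _ _ (HV _ Hx) (HV _ Hy); rewrite unfold_in invgK.
Qed.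

Lemma sub_set_conj (H : Subgroup G) x g :
  sub_set (conj_sub H x) g = sub_set H (g ^ x^-1).
Proof. by []. Qed.

Lemma just_infinite_normal H : just_infinite G -> is_subgroup H ->
  (forall x y, H x -> H (x ^ y)) -> (exists2 x, H x & x <> 1) ->
  virtually_contains H [set: G].
Proof.
move=> [_ jG] sH HJ [x Hx x1]; rewrite -(sub_set_of sH).
apply: finite_index_virtually; first by rewrite sub_set_of; exact: sH.1.
apply: jG => [y|e]; last first.
  apply: x1; have : sub_set (trivial_sub G) x by rewrite -e sub_set_of.
  by move=> /eqP.
apply: sub_set_inj; apply/seteqP; split=> z; rewrite sub_set_conj sub_set_of.
  by move=> /(HJ _ y); rewrite conjgKV.
exact: HJ.
Qed.

End VirtualContainment.

(** * Rigid stabilizers *)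

Section RigidStabilizers.
Variables (G : groupType) (d : nat -> nat) (rho : {multiplicative G -> Aut d}).
Hypothesis faithful : injective rho.
Local Open Scope classical_set_scope.
Local Open Scope group_scope.
Implicit Types (u v w : vertex d) (g h x y : G) (H K L : set G).

Definition below u w := prefix (val u) (val w).

Lemma below_refl u : below u u. Proof. exact: prefix_refl. Qed.

Lemma below_trans v u w : below u v -> below v w -> below u w.
Proof. exact: prefix_trans. Qed.

Lemma below_total u v w : below u w -> below v w -> len u <= len v -> below u v.
Proof.
rewrite /below !prefixE => /eqP uw /eqP vw luv.
by rewrite -vw take_takel // uw.
Qed.

Lemma below_eq u v : below u v -> len u = len v -> u = v.
Proof.
rewrite /below prefixE => /eqP uv luv; apply: val_inj.
by rewrite -uv take_oversize // [leqRHS]luv.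
Qed.

Lemma below_uniq u v w : below u w -> below v w -> len u = len v -> u = v.
Proof.
by move=> uw vw luv; apply: below_eq => //; apply: below_total vw _; rewrite ?luv.
Qed.

Lemma aut_below g u w : below (rho g u) (rho g w) = below u w.
Proof.
apply/idP/idP; last exact: aut_prefix.
by move/(@aut_prefix _ (rho g)^-1); rewrite !aut_fK.
Qed.

Lemma actM g h v : rho (g * h) v = rho h (rho g v).
Proof. by rewrite gmulfM. Qed.

Lemma act1 v : rho 1 v = v.
Proof.
have -> // : rho 1 = 1.
by apply: (@mulgI _ (rho 1)); rewrite -gmulfM !mulg1.
Qed.

Lemma actK g : cancel (rho g) (rho g^-1).
Proof. by move=> v; rewrite -actM mulgV act1. Qed.

Lemma actKV g : cancel (rho g^-1) (rho g).
Proof. by move=> v; rewrite -actM mulVg act1. Qed.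

Lemma act_inj g : injective (rho g).
Proof. exact: can_inj (actK g). Qed.

Lemma act_len g v : len (rho g v) = len v.
Proof. exact: aut_len. Qed.

Lemma act_ext g h : (forall v, rho g v = rho h v) -> g = h.
Proof. by move=> gh; apply: faithful; apply: rooted_autP. Qed.

Lemma act_neq1 g : g <> 1 -> exists v, rho g v <> v.
Proof.
move=> g1; apply: contrapT => /forallNP gv; apply: g1.
by apply: act_ext => v; rewrite act1; exact: contrapT (gv v).
Qed.

Lemma Rist_fix u g : Rist rho u g -> rho g u = u.
Proof.
move=> ug; apply: contrapT => gu; apply/gu/(@act_inj g).
apply: ug; apply/negP => /below_eq; rewrite act_len => /(_ erefl) e.
by apply: gu; rewrite -e.
Qed.

Lemma Rist_subgroup u : is_subgroup (Rist rho u).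
Proof.
split=> [v _|x y ux uy v uv]; first exact: act1.
by rewrite actM -{1}(ux v uv) actK uy.
Qed.

Lemma Rist_below u w g : below u w -> Rist rho w g -> Rist rho u g.
Proof.
move=> uw wg v uv; apply: wg; apply: contra uv; exact: below_trans.
Qed.

Lemma Rist_conj u g x : Rist rho u g -> Rist rho (rho x u) (g ^ x).
Proof.
move=> ug v uv; rewrite conjgE !actM ug ?actKV//.
by rewrite -[prefix _ _](aut_below x) actKV.
Qed.

Lemma Rist_conj_fix u g x : rho x u = u -> Rist rho u g -> Rist rho u (g ^ x).
Proof. by move=> {2}<-; exact: Rist_conj. Qed.

Lemma Rist_moves u g w : Rist rho u g -> rho g w <> w -> below u w.
Proof.
by move=> ug gw; apply: contrapT => /negP uw; apply: gw; exact: ug.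
Qed.

Lemma Rist_commute u v g h : len u = len v -> u != v ->
  Rist rho u g -> Rist rho v h -> commute g h.
Proof.
move=> luv uv ug vh; apply: act_ext => w; rewrite !actM.
case: (boolP (below u w)) => uw.
  have vw z : below u z -> rho h z = z.
    move=> uz; apply: vh; apply: contra uv => vz.
    exact/eqP/(below_uniq uz vz luv).
  by rewrite !vw // -(Rist_fix ug) aut_below.
rewrite [rho g w]ug //; case: (boolP (below v w)) => vw; last by rewrite !vh // ug.
rewrite [RHS]ug //; apply: contra uv => uhw.
apply/eqP/(below_uniq uhw _ luv).
by rewrite -(Rist_fix vh) aut_below.
Qed.

Lemma virtually_contains_Rist_level m K : is_subgroup K ->
  (forall u, len u = m -> virtually_contains K (Rist rho u)) ->
  virtually_contains K (Rist_level rho m).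
Proof.
move=> sK vK.
(* The product over a level is reached by induction over duplicate-free lists of vertices of that
   level. *)
suff vs s : uniq s -> (forall u, u \in s -> len u = m) -> virtually_contains K
    [set \prod_(u <- s) f u | f in
      [set f : vertex d -> G | forall u, len u = m -> Rist rho u (f u)]].
  by apply: vs; [exact: level_uniq | move=> u; rewrite mem_level => /eqP].
elim: s => [_ _|u s IHs /= /andP[us us'] ls].
  exists [:: 1] => _ [f _ <-]; exists 1; rewrite ?inE // big_nil mulg1 invg1.
  exact: sK.1.
have lu : len u = m by apply: ls; rewrite inE eqxx.
have ls' v : v \in s -> len v = m by move=> vs; apply: ls; rewrite inE vs orbT.
apply: (virtually_contains_sub _ _
   (virtually_containsM sK _ (vK u lu) (IHs us' ls'))) => //.
  move=> _ [f fR <-]; rewrite big_cons.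
  exists (f u); first exact: fR.
  by exists (\prod_(v <- s) f v) => //; exists f.
move=> a b _ ua ub [f fR <-]; have uab := (Rist_subgroup u).2 _ _ ua ub.
elim: s us ls' {IHs us' ls} => [_ _|v s IHs].
  by rewrite big_nil; exact: commute1.
rewrite inE negb_or => /andP[uv us] ls.
have lv : len v = m by apply: ls; rewrite inE eqxx.
rewrite big_cons; apply: commuteM.
  by apply: (Rist_commute _ uv uab (fR _ lv)); rewrite lu lv.
by apply: IHs => // w ws; apply: ls; rewrite inE ws orbT.
Qed.

Hypothesis branch : is_branch rho.

(** Here the finite index of [Rist_level] enters: finite index in the whole group can be tested on
    each rigid stabilizer of one level. *)
Lemma virtually_contains_level m K : is_subgroup K ->
  (forall u, len u = m -> virtually_contains K (Rist rho u)) ->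
  virtually_contains K [set: G].
Proof.
move=> sK /(virtually_contains_Rist_level sK) vK.
apply: virtually_contains_trans vK _.
have [_ _ /(_ m)] := branch; apply: finite_index_virtually.
exists (fun=> 1); last by rewrite big1.
by move=> u _; exact: (Rist_subgroup u).1.
Qed.

(** A subgroup [L] of [Rist v] is traded for a subgroup of the whole group that induces the same
    action below [v]. It has finite index as soon as [L] has finite index in [Rist v], and it meets
    [Rist v] in [L]. *)
Definition extension v L : set G :=
  [set g | exists2 a, L a & forall w, below v w -> rho g w = rho a w].

Lemma extension_subgroup v L : is_subgroup L -> L `<=` Rist rho v ->
  is_subgroup (extension v L).
Proof.
move=> sL Lv; split=> [|g h [a La ga] [b Lb hb]]; first by exists 1 => //; exact: sL.1.
exists (a^-1 * b) => [|w vw]; first exact: sL.2.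
have va' : below v (rho a^-1 w).
  by rewrite -(Rist_fix (Lv _ (subgroupV sL La))) aut_below.
rewrite !actM -hb//; congr (rho h _); apply: (@act_inj g).
by rewrite actKV ga // actKV.
Qed.

Lemma extension_Rist v L g : L `<=` Rist rho v -> extension v L g ->
  Rist rho v g -> L g.
Proof.
move=> Lv [a La ga] vg; suff -> : g = a by [].
apply: act_ext => w; case: (boolP (below v w)) => [/ga//|vw].
by rewrite vg // Lv.
Qed.

(** Rigid stabilizers of vertices of level [m] outside the subtree at [v] act trivially below [v],
    so the extension contains them entirely. *)
Lemma virtually_contains_extension v L m : is_subgroup L -> L `<=` Rist rho v ->
  len v <= m ->
  (forall u, len u = m -> below v u -> virtually_contains L (Rist rho u)) ->
  virtually_contains (extension v L) [set: G].
Proof.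
move=> sL Lv vm vL; apply: (@virtually_contains_level m).
  exact: extension_subgroup.
move=> u lu; case: (boolP (below v u)) => [vu|vu].
  by apply: (virtually_contains_sub _ _ (vL u lu vu)) => // a La; exists a.
exists [:: 1] => a ua; exists 1; rewrite ?inE //.
exists 1 => [|w vw]; first exact: sL.1.
rewrite invg1 mul1g act1 ua //; apply: contra vu => uw.
by apply: below_total vw uw _; rewrite lu.
Qed.

(** The detour through the whole group makes the branch property available: the extension of the
    part of [K] in [Rist v] has finite index, and intersecting with [Rist v] gives that part
    back. *)
Lemma virtually_contains_below v K m : is_subgroup K -> len v <= m ->
  (forall u, len u = m -> below v u -> virtually_contains K (Rist rho u)) ->
  virtually_contains K (Rist rho v).
Proof.
move=> sK vm vK; have sKv := is_subgroupI sK (Rist_subgroup v).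
have Kv : K `&` Rist rho v `<=` Rist rho v by move=> ? [].
have vE : virtually_contains (extension v (K `&` Rist rho v)) [set: G].
  apply: (virtually_contains_extension sKv Kv vm) => u lu vu.
  apply: (virtually_contains_sub _ _
    (virtually_containsIr sK (Rist_subgroup u) (vK u lu vu))) => //.
  by apply: setIS => g; exact: Rist_below.
have sE := extension_subgroup sKv Kv.
have vEv : virtually_contains (extension v (K `&` Rist rho v)) (Rist rho v).
  exact: (virtually_contains_sub _ _ vE).
apply: (virtually_contains_sub _ _ (virtually_containsIr sE (Rist_subgroup v) vEv)) => //.
by move=> g [Eg vg]; have [] := extension_Rist Kv Eg vg.
Qed.

(** The rigid stabilizers of one level are conjugate by transitivity. If they were finite, the
    trivial subgroup would have finite index. *)
Lemma Rist_infinite u : just_infinite G ->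
  ~ virtually_contains [set 1] (Rist rho u).
Proof.
move=> [infG _] fu; have s1 : is_subgroup [set (1 : G)].
  by split=> // x y -> ->; rewrite invg1 mulg1.
have [s Hs] : virtually_contains [set 1] [set: G].
  apply: (@virtually_contains_level (len u)) => // v lv.
  have [tr _ _] := branch; have [x <-] := tr u v (esym lv).
  have := virtually_contains_conj x^-1 s1 fu.
  apply: virtually_contains_sub => g /=.
    by move=> e; apply: (@conjg_inj _ x^-1); rewrite conj1g.
  by move=> /(@Rist_conj _ _ x^-1); rewrite actK.
apply: infG; apply: (@sub_finite_set _ _ [set` s]); last exact: finite_seq.
by move=> g _; have [//|x xs /= /mulg1_eq] := Hs g; rewrite invgK => <-.
Qed.

(** Choose [a] moving some [w] below [u], and [b] in [Rist w] moving some [z]. The image of [z]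
    under [a] leaves the subtree at [w], so [b] fixes it; were [a] and [b] to commute, [b] would fix
    [z] as well. *)
Lemma Rist_nonabelian u K : just_infinite G -> is_subgroup K ->
  virtually_contains K [set: G] ->
  exists a b, [/\ K a, K b, Rist rho u a, Rist rho u b & [~ a, b] <> 1].
Proof.
move=> jG sK vK.
have ntK v : exists a, [/\ K a, Rist rho v a & a <> 1].
  apply: contrapT => /forallNP nK; apply: (@Rist_infinite v jG).
  have vKv : virtually_contains K (Rist rho v).
    exact: (virtually_contains_sub _ _ vK).
  apply: (virtually_contains_sub _ _
    (virtually_containsIr sK (Rist_subgroup v) vKv)) => //.
  by move=> a [Ka va]; apply: contrapT => a1; apply: (nK a).
have [a [Ka ua a1]] := ntK u; have [w aw] := act_neq1 a1.
have uw := Rist_moves ua aw.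
have [b [Kb wb b1]] := ntK w; have [z bz] := act_neq1 b1.
have wz := Rist_moves wb bz.
exists a, b; split => //; first exact: Rist_below uw wb.
move=> /eqP/commgP e; apply: bz; apply: (@act_inj a).
have := congr1 (fun g => rho g z) e; rewrite !actM => <-.
apply: wb; apply/negP => waz; apply: aw.
apply: (below_uniq _ waz); last exact: act_len.
by rewrite aut_below.
Qed.

(* The elements all of whose conjugates act below [u] like elements of
   [H `&` Rist u] form a normal subgroup, which is non-trivial, hence of finite
   index, because it contains commutators of elements of a finite index normal
   subgroup. *)
Lemma virtually_contains_commutators u H L : just_infinite G ->
  is_subgroup H -> is_subgroup L -> L `<=` Rist rho u ->
  virtually_contains L (Rist rho u) ->
  (forall a b, L a -> L b -> H [~ a, b]) ->
  virtually_contains H (Rist rho u).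
Proof.
move=> jG sH sL Lu vL HL.
have vE : virtually_contains (extension u L) [set: G].
  apply: (virtually_contains_extension sL Lu (leqnn _)) => v lv uv.
  by rewrite -(below_eq uv (esym lv)).
have sE := extension_subgroup sL Lu.
have vM := virtually_contains_core sE vE.
set M := (X in virtually_contains X _) in vM.
have sM : is_subgroup M.
  split=> [x|x y Mx My z]; first by rewrite conj1g; exact: sE.1.
  by rewrite conjMg conjVg; apply: sE.2; [exact: Mx|exact: My].
have [a [b [Ma Mb ua ub ab1]]] := Rist_nonabelian u jG sM vM.
have ML x c : rho x u = u -> M c -> Rist rho u c -> L (c ^ x).
  move=> xu Mc uc; apply: (extension_Rist Lu (Mc x)).
  exact: Rist_conj_fix.
have sHu := is_subgroupI sH (Rist_subgroup u).
have Hu : H `&` Rist rho u `<=` Rist rho u by move=> ? [].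
have sEu := extension_subgroup sHu Hu.
pose N : set G := [set g | forall x, extension u (H `&` Rist rho u) (g ^ x)].
have sN : is_subgroup N.
  split=> [x|x y Nx Ny z]; first by rewrite conj1g; exact: sEu.1.
  by rewrite conjMg conjVg; apply: sEu.2; [exact: Nx|exact: Ny].
have uab : Rist rho u [~ a, b].
  have sR := Rist_subgroup u.
  rewrite commgEl; apply: sR.2 => //.
  exact: Rist_conj_fix (Rist_fix ub) ua.
have vN : virtually_contains N [set: G].
  apply: just_infinite_normal => // [x y Nx z|].
    by rewrite -conjgM.
  exists [~ a, b] => // x; have [xu|/eqP xu] := eqVneq (rho x u) u.
    exists ([~ a, b] ^ x) => //; split; last exact: Rist_conj_fix.
    by rewrite conjRg; apply: HL; exact: ML.
  (* When [x] moves [u], the conjugated commutator lives on another subtree and acts trivially below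
     [u]. *)
  exists 1; first exact: sHu.1.
  move=> w uw; rewrite act1 (Rist_conj (x := x) uab) //; apply/negP => xuw.
  by apply: xu; apply: (below_uniq xuw uw); rewrite act_len.
have vNu : virtually_contains N (Rist rho u) by exact: (virtually_contains_sub _ _ vN).
apply: (virtually_contains_sub _ _ (virtually_containsIr sN (Rist_subgroup u) vNu)) => //.
move=> g [/(_ 1)]; rewrite conjg1 => Eg ug.
by have [] := extension_Rist Hu Eg ug.
Qed.

(** For distinct [u] and [u'] of one level and a subgroup [H], this is the projection to [Rist u] of
    the part of [H] inside the direct product of [Rist u] and [Rist u']. *)
Definition rist_projection H u u' : set G :=
  [set a | Rist rho u a /\ exists2 b, Rist rho u' b & H (a * b)].

Lemma rist_projection_subgroup H u v : is_subgroup H ->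
  len u = len v -> u != v -> is_subgroup (rist_projection H u v).
Proof.
move=> sH luv uv; have sR := Rist_subgroup; split=> [|a a'].
  split; first exact: (sR u).1.
  by exists 1; rewrite ?mulg1; [exact: (sR v).1|exact: sH.1].
move=> [ua [b vb Hab]] [ua' [b' vb' Hab']]; split; first exact: (sR u).2.
exists (b^-1 * b'); first exact: (sR v).2.
rewrite -invgM_commute; first exact: sH.2.
by apply: (Rist_commute luv uv _ vb); exact: (sR u).2.
Qed.

Hypothesis d_ge2 : forall i, 2 <= d i.

Lemma size_level n : 2 ^ n <= size (level d n).
Proof.
rewrite size_pmap_sub (@eq_in_count _ _ predT) => [|w]; last first.
  by rewrite mem_words => /andP[].
rewrite count_predT; elim: n d d_ge2 => //= n IHn d' d'2.
rewrite size_allpairs size_iota expnS leq_mul // IHn // => i.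
exact: d'2.
Qed.

Lemma is_word_nseq0 n : is_word d (nseq n 0).
Proof.
elim: n d d_ge2 => //= n IHn d' d'2; rewrite IHn ?andbT => [|i]; last exact: d'2.
exact: ltnW.
Qed.

(** If [L] fixes [u], then so does its extension, and the orbit of [u] has at most as many points as
    the extension has cosets. By transitivity the orbit is a full level, which is too large once [m]
    is at least the number of coset representatives. *)
Lemma level_moved v L : is_subgroup L -> L `<=` Rist rho v ->
  virtually_contains L (Rist rho v) ->
  exists2 m, len v <= m &
    forall u, len u = m -> below v u -> exists2 a, L a & rho a u <> u.
Proof.
move=> sL Lv vL; have sE := extension_subgroup sL Lv.
have [s Hs] : virtually_contains (extension v L) [set: G].
  apply: (virtually_contains_extension sL Lv (leqnn _)) => u lu vu.
  by rewrite -(below_eq vu (esym lu)).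
exists (maxn (len v) (size s)) => [|u lu vu]; first exact: leq_maxl.
apply: contrapT => /forall2NP nL.
have Eu g : extension v L g -> rho g u = u.
  by move=> [a La ->//]; have [//|/contrapT] := nL a.
have /choice[p Hp] (w : vertex d) : exists p : G * G, len w = len u ->
    [/\ p.1 \in s, rho p.2 u = w & extension v L (p.1^-1 * p.2^-1)].
  have [lw|/eqP lw] := eqVneq (len w) (len u); last by exists (1, 1).
  have [tr _ _] := branch; have [g gw] := tr u w (esym lw).
  by have [//|x xs Ex] := Hs g^-1; exists (x, g).
have : size (level d (len u)) <= size s.
  rewrite -(size_map (fun w => (p w).1)); apply: uniq_leq_size.
    rewrite map_inj_in_uniq; first exact: level_uniq.
    move=> w w'; rewrite !mem_level => /eqP/Hp[_ gw Ew] /eqP/Hp[_ gw' Ew'] /= e.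
    have := Eu _ (sE.2 _ _ Ew Ew').
    rewrite e invgM !invgK -mulgA mulVKg actM gw => wu.
    by rewrite -gw' -wu actKV.
  by move=> _ /mapP[w + ->]; rewrite mem_level => /eqP/Hp[].
apply/negP; rewrite -ltnNge; apply: leq_trans (size_level _).
by apply: (leq_trans (ltn_expl _ (ltnSn 1))); rewrite leq_exp2l // lu leq_maxr.
Qed.

(* If [u] lies below [v], then [u], its image under [gamma] and its image under
   a second element of [H] are three distinct vertices; commutators of
   elements of [H] lying over [u] and one or the other of the two images
   then are commutators of elements of [Rist u]. *)
Lemma virtually_contains_moved H gamma v : just_infinite G -> is_subgroup H ->
  (forall g u, H g -> rho g u <> u ->
    virtually_contains (rist_projection H u (rho g u)) (Rist rho u)) ->
  H gamma -> rho gamma v <> v -> virtually_contains H (Rist rho v).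
Proof.
move=> jG sH vH Hgamma gv.
have sP g u : rho g u <> u -> is_subgroup (rist_projection H u (rho g u)).
  move=> gu; apply: rist_projection_subgroup; rewrite ?act_len//.
  by apply/eqP => e; exact: gu.
have [|m vm Hm] := level_moved (sP _ _ gv) _ (vH _ _ Hgamma gv).
  by move=> a [].
apply: (virtually_contains_below sH vm) => u lu vu.
have [a [va [b gb Hab]] au] := Hm u lu vu.
have vau : below v (rho a u) by rewrite -(Rist_fix va) aut_below.
have gvu : below (rho gamma v) (rho gamma u) by rewrite aut_below.
have lgv : len (rho gamma v) = len v by rewrite act_len.
(* The second element of [H] is [a * b]: since [b] acts only below the image of [v] under [gamma],
   it leaves alone the image of [u] under [a], which is still below [v]. *)
have eab : rho (a * b) u = rho a u.
  rewrite actM; apply: gb; apply/negP => gva; apply: gv.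
  exact: below_uniq gva vau lgv.
have gu : rho gamma u <> u.
  by move=> e; apply: gv; apply: (below_uniq _ vu lgv); rewrite -e.
have abu : rho (a * b) u <> u by rewrite eab.
have gab : rho gamma u != rho (a * b) u.
  rewrite eab; apply/eqP => e; apply: gv.
  by apply: (below_uniq _ vau lgv); rewrite -e.
have sL := is_subgroupI (sP _ _ gu) (sP _ _ abu).
apply: (@virtually_contains_commutators u H _ jG sH sL) => [x [[]] //||].
  by apply: virtually_containsI; [exact: sP|exact: sP|exact: vH|exact: vH].
move=> x y [[ux [x' gx' Hx]] _] [_ [uy [y' aby' Hy]]].
have lg g z z' : rho g u <> u -> Rist rho u z -> Rist rho (rho g u) z' ->
    commute z z'.
  move=> wu uz wz'; apply: (Rist_commute _ _ uz wz'); first by rewrite act_len.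
  by apply/eqP => e; exact: wu.
have xx' := lg _ _ _ gu ux gx'; have yx' := lg _ _ _ gu uy gx'.
have xy' := lg _ _ _ abu ux aby'; have yy' := lg _ _ _ abu uy aby'.
have x'y' : commute x' y'.
  by apply: (Rist_commute _ gab gx' aby'); rewrite !act_len.
(* The factors [x'] and [y'] live over two distinct vertices, both different from [u], so they
   commute with each other and with [x] and [y], and cancel. *)
suff <- : [~ x * x', y * y'] = [~ x, y].
  rewrite commgEl conjgE; apply: sH.2 => //; apply: sH.2 => //.
  exact: subgroupM.
apply: (@mulgI _ ((y * y') * (x * x'))); rewrite -commgC.
have -> : x * x' * (y * y') = (x * y) * (x' * y').
  by rewrite -!mulgA; congr (_ * _); rewrite !mulgA yx'.
have -> : y * y' * (x * x') = (y * x) * (x' * y').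
  by rewrite x'y' -!mulgA; congr (_ * _); rewrite !mulgA xy'.
rewrite -(mulgA (y * x)).
suff -> : commute (x' * y') [~ x, y] by rewrite [RHS]mulgA -commgC.
by apply/commute_sym/commuteM; apply/commute_sym; rewrite commgEl conjgE;
  do ?[apply: commuteM|apply: commuteV]; exact: commute_sym.
Qed.

End RigidStabilizers.

(** * Approximation by finite index subgroups *)

Section Approximation.
Variables (G : groupType) (d : nat -> nat) (rho : {multiplicative G -> Aut d}).
Local Open Scope classical_set_scope.
Local Open Scope group_scope.
Implicit Types (u v w : vertex d) (g h x y : G) (H : set G) (F : set (vertex d)).

Lemma virtually_contains_fix (s : seq (vertex d)) :
  virtually_contains [set g | forall w, w \in s -> rho g w = w] [set: G].
Proof.
have sub1 w : is_subgroup [set g | rho g w = w].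
  split=> [|a b /= aw bw]; first exact: act1.
  by rewrite actM -{1}aw actK.
have sfix (t : seq (vertex d)) : is_subgroup [set g | forall w, w \in t -> rho g w = w].
  split=> [w _|a b Ha Hb w wt]; first exact: act1.
  by apply: (sub1 w).2; [exact: Ha|exact: Hb].
elim: s => [|u s IHs].
  by exists [:: 1] => a _; exists 1; rewrite ?inE.
apply: (@virtually_contains_sub _ ([set g | rho g u = u] `&`
    [set g | forall w, w \in s -> rho g w = w]) _ [set: G]) => //.
  by move=> g [gu gs] w; rewrite inE => /orP[/eqP->|/gs].
apply: virtually_containsI => //; apply/virtually_containsP => //.
exists 'I_(size (level d (len u))).+1.
(* The inverse is due to the right action: [a^-1 * b] fixes [u] exactly when [a^-1] and [b^-1] send
   [u] to the same vertex. *)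
exists (fun g => inord (index (rho g^-1 u) (level d (len u)))) => a b _ _.
have lev g : rho g^-1 u \in level d (len u) by rewrite mem_level act_len.
move/(congr1 val); rewrite /= !inordK ?ltnS ?index_size // => e.
have := congr1 (nth u (level d (len u))) e; rewrite !nth_index // => e'.
by rewrite actM e' actKV.
Qed.

Definition approximation F n m H : set G :=
  [set g | exists2 h, H h & forall v, len v = n ->
    F v /\ (forall w, below v w -> rho h w = w /\ (len w <= m -> rho g w = w)) \/
    ~ F v /\ (forall w, below v w -> rho g w = rho h w)].

(** The witnesses in [H] fix the vertices of [F] on level [n], hence permute the others. Below those
    others an element agrees with its witness, so quotients can be computed on witnesses. *)
Lemma approximation_subgroup F n m H : n <= m -> is_subgroup H ->
  is_subgroup (approximation F n m H).
Proof.
move=> nm sH; split=> [|g1 g2 [h1 H1 gh1] [h2 H2 gh2]].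
  exists 1; first exact: sH.1.
  move=> v _; have [Fv|Fv] := pselect (F v); [left|right]; split=> // w _.
  by rewrite act1.
exists (h1^-1 * h2); first exact: sH.2.
have fixV g w : rho g w = w -> rho g^-1 w = w by move=> gw; rewrite -{1}gw actK.
move=> v lv; have [[Fv gv1]|[Fv _]] := gh1 v lv.
  left; split=> // w vw; have [hw1 gw1] := gv1 w vw.
  have [[_ /(_ w vw)[hw2 gw2]]|[]//] := gh2 v lv.
  split=> [|wm]; first by rewrite actM fixV.
  by rewrite actM fixV ?gw1 ?gw2.
right; split=> // w vw; rewrite !actM.
have lv' : len (rho h1^-1 v) = n by rewrite act_len.
have vw' : below (rho h1^-1 v) (rho h1^-1 w) by rewrite aut_below.
have nF : ~ F (rho h1^-1 v).
  move=> Fv'; have [[_ /(_ _ (below_refl _))[]]|[]//] := gh1 _ lv'.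
  by rewrite actKV => e _; apply: Fv; rewrite e.
have [[]//|[_ /(_ _ vw')]] := gh1 _ lv'.
rewrite actKV => /(congr1 (rho g1^-1)); rewrite actK => <-.
by have [[]//|[_ /(_ _ vw')]] := gh2 _ lv'.
Qed.

Lemma approximation_conj F n m H x g : approximation F n m H g ->
  approximation [set v | F (rho x^-1 v)] n m [set h | H (h ^ x^-1)] (g ^ x).
Proof.
move=> [h Hh gh]; exists (h ^ x); first by rewrite /= conjgK.
move=> v lv; have lv' : len (rho x^-1 v) = n by rewrite act_len.
have xw w : below v w -> below (rho x^-1 v) (rho x^-1 w) by rewrite aut_below.
have [[Fv gv]|[Fv gv]] := gh _ lv'; [left|right]; split=> // w /xw/gv.
  move=> [hw gw]; rewrite !conjgE !actM hw actKV; split=> // wm.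
  by rewrite gw ?actKV // act_len.
by move=> gw; rewrite !conjgE !actM gw.
Qed.

Lemma autsec1 (g : Aut d) v w : autsec g v = 1 -> g v = v -> below v w -> g w = w.
Proof.
move=> g1 gv vw; apply: val_inj.
have ww : is_word (iter (len v) shiftd d) (drop (len v) (val w)).
  have := valP w; rewrite -{1}(cat_take_drop (len v) (val w)) is_word_cat.
  by move: vw; rewrite /below prefixE => /eqP -> /andP[].
have -> : w = vcat (erefl (len v)) (exist (is_word _) _ ww).
  apply: val_inj => /=; move: vw; rewrite /below prefixE => /eqP {1}<-.
  by rewrite cat_take_drop.
by rewrite autsecE g1 gv.
Qed.

(** Beyond both [n_g] and [i0] a non-trivial section lies in [N] and moves some word of length at
    most [c0]. Appending this word to [v] gives [w]; when [g] fixes [v], it acts below [v] through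
    the section. *)
Lemma contraction_moves (N : forall i, set (Aut (iter i shiftd d))) c0 i0 :
  (forall g : G, exists n_g : nat, forall v : vertex d,
     n_g <= len v -> N (len v) (autsec (rho g) v)) ->
  (forall i, i0 <= i -> forall gamma, N i gamma -> gamma <> 1 ->
     trunc c0 gamma <> 1) ->
  forall g, exists n0, forall v, n0 <= len v -> autsec (rho g) v <> 1 ->
    exists w, [/\ below v w, len w <= len v + c0 &
      rho g v = v -> rho g w <> w].
Proof.
move=> gN Nc g; have [n Hn] := gN g; exists (maxn n i0) => v.
rewrite geq_max => /andP[nv iv] gv.
have tv := Nc _ iv _ (Hn _ nv) gv.
have [[w wc] ww] : exists w : tvertex (iter (len v) shiftd d) c0,
    autsec (rho g) v (val w) <> val w.
  apply: contrapT => /forallNP nw; apply: tv; apply: rooted_autP => w.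
  by apply: val_inj; exact: contrapT (nw w).
exists (vcat (erefl (len v)) w); split.
- exact: prefix_prefix.
- by rewrite /len /= size_cat leq_add2l.
move=> gvv /(congr1 val); rewrite autsecE gvv /= => /eqP.
by rewrite eqseq_cat // eqxx /= => /eqP e; apply: ww; exact: val_inj.
Qed.

Hypothesis d_ge2 : forall i, 2 <= d i.

Lemma below_extend v n : len v <= n -> exists2 w, below v w & len w = n.
Proof.
move=> vn; have sd i k : (iter i shiftd d) k = d (i + k).
  by elim: i k => //= i IHi k; rewrite /shiftd IHi addnS.
have w0 : is_word (iter (len v) shiftd d) (nseq (n - len v) 0).
  by apply: is_word_nseq0 => k; rewrite sd.
exists (vcat (erefl (len v)) (exist (is_word _) _ w0)).
  exact: prefix_prefix.
by rewrite /len /= size_cat size_nseq subnKC.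
Qed.

Hypothesis faithful : injective rho.

(** Below a vertex of [F], the element [g] fixes all levels up to [n + c0], which by contraction
    forces a trivial section there. So [g] agrees with its witness [h] everywhere, and faithfulness
    gives equality. *)
Lemma approximation_sub F n c0 H g : is_subgroup H ->
  (forall v, len v = n -> autsec (rho g) v <> 1 ->
    exists w, [/\ below v w, len w <= n + c0 & rho g v = v -> rho g w <> w]) ->
  approximation F n (n + c0) H g -> H g.
Proof.
move=> sH Hg [h Hh gh]; suff -> : g = h by [].
apply: (act_ext faithful).
have ghn v w : len v = n -> below v w -> rho g w = rho h w.
  move=> lv vw; have [[Fv gv]|[_ /(_ w vw)//]] := gh v lv.
  have [hw _] := gv w vw; rewrite hw.
  have [_ gvv] := gv v (below_refl v); rewrite lv leq_addr in gvv.
  apply: autsec1 (gvv isT) vw; apply: contrapT => g1.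
  by have [z [vz lz]] := Hg v lv g1; apply; [exact: gvv|exact: (gv z vz).2].
move=> w; have [nw|/ltnW wn] := leqP n (len w).
  have tw : is_word d (take n (val w)).
    by have := valP w; rewrite -{1}(cat_take_drop n (val w)) is_word_cat => /andP[].
  apply: (ghn (exist (is_word d) _ tw)); first by rewrite /len /= size_takel.
  by rewrite /below /= prefix_take.
(* Above level [n], the image of a vertex is determined by the image of any descendant on level
   [n]. *)
have [v wv lv] := below_extend wn.
have gv := ghn v v lv (below_refl v).
apply: (@below_uniq _ _ _ (rho g v)); first by rewrite aut_below.
  by rewrite gv aut_below.
by rewrite !act_len.
Qed.

Lemma sub_approximation F n m H g : H g ->
  (forall v, len v = n -> F v -> rho g v = v) ->
  (forall v, len v = n -> autsec (rho g) v <> 1 -> ~ F v) ->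
  approximation F n m H g.
Proof.
move=> Hg Fg Fs; exists g => // v lv.
have [Fv|nFv] := pselect (F v); [left|right]; split=> // w vw.
have gv1 : autsec (rho g) v = 1 by apply: contrapT => /(Fs _ lv).
by have gw := autsec1 gv1 (Fg _ lv Fv) vw.
Qed.

Hypothesis branch : is_branch rho.

(** Tested on [Rist v] for [v] of level [n]. If [v] is outside [F], elements of [H] in [Rist v] are
    their own witnesses; if [v] is in [F], the elements of [Rist v] fixing all levels up to [m] have
    witness 1. *)
Lemma approximation_finite_index n m H : is_subgroup H -> n <= m ->
  finite_index (approximation
    [set v | ~ virtually_contains H (Rist rho v)] n m H).
Proof.
set F := (X in approximation X); move=> sH nm.
have sA := approximation_subgroup F nm sH.
have sR := @Rist_subgroup G d rho.
apply: virtually_finite_index => //.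
apply: (virtually_contains_level faithful branch sA (m := n)) => v lv.
have sep u w : len u = n -> u != v -> below u w -> ~~ below v w.
  move=> lu uv uw; apply: contra uv => vw; apply/eqP/(below_uniq uw vw).
  by rewrite lu.
have [Fv|Fv] := pselect (F v); last first.
  have /(virtually_containsIr sH (sR v)) vH : virtually_contains H (Rist rho v).
    exact: contrapT.
  apply: (virtually_contains_sub _ _ vH) => // g [Hg vg]; exists g => // u lu.
  have [Fu|Fu] := pselect (F u); [left|right]; split=> // w uw.
  suff gw : rho g w = w by [].
  apply: vg; apply: sep uw => //; apply/eqP => e; apply: Fv; rewrite -e.
  exact: Fu.
pose s : seq (vertex d) := flatten [seq level d i | i <- iota 0 m.+1].
have sfix : is_subgroup [set g | forall w, w \in s -> rho g w = w].
  split=> [w _|a b Ha Hb w ws]; first exact: act1.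
  by rewrite actM -{1}(Ha w ws) actK Hb.
have vs : virtually_contains [set g | forall w, w \in s -> rho g w = w] (Rist rho v).
  exact: (virtually_contains_sub _ _ (virtually_contains_fix s)).
apply: (virtually_contains_sub _ _ (virtually_containsIr sfix (sR v) vs)) => //.
move=> g [gs vg]; exists 1; first exact: sH.1.
move=> u lu; have [Fu|Fu] := pselect (F u); [left|right]; split=> // w uw.
  rewrite act1; split=> // wm; apply: gs; apply/flattenP.
  exists (level d (len w)); last by rewrite mem_level.
  by apply: map_f; rewrite mem_iota.
rewrite act1; apply: vg; apply: sep uw => //; apply/eqP => e.
by apply: Fu; rewrite e.
Qed.

End Approximation.

(** * The space of subgroups *)

Section SubgroupTopology.
Variable G : groupType.
Local Open Scope classical_set_scope.
Implicit Types (H K : Subgroup G) (x : G) (s : seq G).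

Definition cylinder H s : set (Subgroup G) :=
  [set K | forall x, x \in s -> sub_set K x <-> sub_set H x].

(** The sets containing a cylinder around [f] form a filter that converges to [f] in each
    coordinate, hence in the product topology. *)
Lemma ptws_cylinder (f : {ptws G -> bool}) (A : set {ptws G -> bool}) :
  nbhs f A -> exists s, forall g : {ptws G -> bool},
    (forall x, x \in s -> g x = f x) -> A g.
Proof.
pose F : set_system {ptws G -> bool} := [set A | exists s : seq G,
  forall g : {ptws G -> bool}, (forall x, x \in s -> g x = f x) -> A g].
have FF : Filter F.
  split=> [|P Q [s Ps] [t Qt]|P Q PQ [s Ps]]; first by exists [::].
    exists (s ++ t) => g gst; split; [apply: Ps|apply: Qt] => x xs; apply: gst.
      by rewrite mem_cat xs.
    by rewrite mem_cat xs orbT.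
  by exists s => g /Ps /PQ.
suff : F --> f by apply.
apply/cvg_sup => x; apply/cvg_image => [|B /nbhs_singleton Bx].
  by apply/seteqP; split=> // b _; exists (fun=> b).
exists [set g | B (g x)]; last first.
  by apply/seteqP; split=> [b [g Bg <-] //|b Bb]; exists (fun=> b).
by exists [:: x] => g /(_ x) gx; rewrite /= gx ?inE.
Qed.

Lemma nbhs_cylinder H (A : set (Subgroup G)) : nbhs H A ->
  exists s, cylinder H s `<=` A.
Proof.
case=> _ [[B oB <-] BH BA].
have [s Bs] := ptws_cylinder (open_nbhs_nbhs (conj oB BH)).
exists s => K Ks; apply: BA; apply: Bs => x xs.
by have [KH HK] := Ks x xs; apply/idP/idP; [exact: KH|exact: HK].
Qed.

Lemma open_mem x (b : bool) : open [set H : Subgroup G | (val H : G -> bool) x = b].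
Proof.
pose B : set {ptws G -> bool} := [set f | f x = b].
suff oB : open B by exists B.
have pc : continuous (proj x : {ptws G -> bool} -> bool) := @proj_continuous _ _ x.
exact: ((continuousP _).1 pc [set b] (discrete_open _)).
Qed.

Lemma open_cylinder H s : open (cylinder H s).
Proof.
elim: s => [|x s IHs].
  by rewrite (_ : cylinder _ _ = setT); [exact: openT|exact/seteqP].
rewrite (_ : cylinder _ _ =
    [set K | (val K : G -> bool) x = (val H : G -> bool) x] `&` cylinder H s).
  by apply: openI => //; exact: open_mem.
apply/seteqP; split=> K /=.
  move=> KH; split=> [|y ys]; last by apply: KH; rewrite inE ys orbT.
  by have [] := KH x (mem_head _ _) => a b; apply/idP/idP.
move=> [KHx KH] y; rewrite inE => /orP[/eqP->|/KH//].
by rewrite /sub_set /= KHx.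
Qed.

(** An ultrafilter converges to the set [K] of elements lying in almost every subgroup in its sense;
    the subgroup laws pass to [K]. *)
Lemma compact_Subgroup : compact [set: Subgroup G].
Proof.
rewrite compact_ultra => F FU _.
pose K : set G := [set x | F [set H : Subgroup G | sub_set H x]].
have FF : ProperFilter F by exact: ultra_proper.
have sK : is_subgroup K.
  split=> [|x y]; rewrite /K /=.
    by apply: filterS (filterT : F setT) => H _ /=; have [] := sub_set_subgroup H.
  by move=> Fx Fy; apply: filterS2 Fx Fy => H; have [_] := sub_set_subgroup H; apply.
exists (subgroup_of sK); split=> // A /nbhs_cylinder[s] /filterS; apply.
elim: s => [|x s IHs].
  by apply: filterS (filterT : F setT) => H _ y.
have Fx : F [set H | sub_set H x <-> K x].
  have [Kx|nKx] := pselect (K x); first by apply: filterS (Kx) => H Hx; split.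
  have [//|] := in_ultra_setVsetC [set H | sub_set H x] FU.
  by apply: filterS => H Hx; split.
apply: filterS2 Fx IHs => H Hx Hs y.
by rewrite inE sub_set_of => /orP[/eqP->//|/Hs]; rewrite sub_set_of.
Qed.

Local Open Scope ring_scope.

(** Uniform continuity by compactness: [s] collects the coordinates of a finite cover by cylinders
    on which [f] stays within [e / 2] of its value at the centre. *)
Lemma continuous_modulus (R : realType) (f : Subgroup G -> R) : continuous f ->
  forall e, 0 < e -> exists s, forall H K, cylinder H s K -> `|f H - f K| < e.
Proof.
move=> cf e e0.
have e20 : 0 < e / 2 by rewrite divr_gt0.
have /choice[s Hs] H : exists s, forall K, cylinder H s K -> `|f H - f K| < e / 2.
  by have /cvgrPdist_lt/(_ _ e20)/nbhs_cylinder[s Hs] := cf H; exists s => K /Hs.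
have := compact_Subgroup; rewrite compact_cover.
move=> /(_ _ setT (fun H => cylinder H (s H))) [||D _ Dc].
- by move=> H _; exact: open_cylinder.
- by move=> H _; exists H.
exists (flatten [seq s H | H <- finmap.enum_fset D]) => H K HK.
have [L LD LH] := Dc H I.
have LK : cylinder L (s L) K.
  move=> x xs; rewrite -(LH x xs); apply: HK; apply/flattenP.
  by exists (s L) => //; apply: map_f.
rewrite (splitr e) -(subrKA (f L)) -opprB (le_lt_trans (ler_normD _ _)) //.
by rewrite ltrD // ?normrN; [exact: Hs|exact: Hs].
Qed.

Lemma continuous_bounded (R : realType) (f : Subgroup G -> R) : continuous f ->
  exists M, forall H, `|f H| <= M.
Proof.
move=> cf.
have fT : (f @` [set: Subgroup G]) (f (trivial_sub G)) by exists (trivial_sub G).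
have PF := globally_properfilter fT.
have /compact_bounded/ex_bound[M HM] : compact (f @` [set: Subgroup G]).
  by apply: continuous_compact compact_Subgroup; exact: continuous_subspaceT.
by exists M => H; apply: HM; exists H.
Qed.

End SubgroupTopology.

(** * Measurability and weak convergence *)

Section MeasurableEvents.
Local Open Scope classical_set_scope.

Lemma countable_seq (U : Type) : countable [set: U] -> countable [set: seq U].
Proof.
move=> /countable_injP[f injf]; apply/countable_injP.
exists (fun s => pickle [seq f x | x <- s]) => s t _ _.
move/(pcan_inj pickleK)/inj_map; apply => x y; apply: injf; exact: in_setT.
Qed.

Context d (T : measurableType d).

Lemma measurable_exists (U : Type) (P : U -> T -> Prop) : countable [set: U] ->
  (forall i, measurable [set x | P i x]) -> measurable [set x | exists i, P i x].
Proof.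
move=> cU mP; rewrite (_ : [set x | _] = \bigcup_i [set x | P i x]).
  exact: countable_bigcupT_measurable.
by apply/seteqP; split=> x [i]; [exists i|exists i].
Qed.

Lemma measurable_not (P : T -> Prop) : measurable [set x | P x] ->
  measurable [set x | ~ P x].
Proof. exact: measurableC. Qed.

Lemma measurable_const (P : Prop) : measurable [set x : T | P].
Proof.
have [p|np] := pselect P.
  by rewrite (_ : [set x | _] = setT) //; apply/seteqP; split.
by rewrite (_ : [set x | _] = set0) //; apply/seteqP; split.
Qed.

Lemma measurable_and (P Q : T -> Prop) : measurable [set x | P x] ->
  measurable [set x | Q x] -> measurable [set x | P x /\ Q x].
Proof. exact: measurableI. Qed.

Lemma measurable_or (P Q : T -> Prop) : measurable [set x | P x] ->
  measurable [set x | Q x] -> measurable [set x | P x \/ Q x].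
Proof. exact: measurableU. Qed.

Lemma measurable_imply (P Q : T -> Prop) : measurable [set x | P x] ->
  measurable [set x | Q x] -> measurable [set x | P x -> Q x].
Proof.
move=> mP mQ; rewrite (_ : [set x | _] = [set x | ~ P x \/ Q x]).
  exact/measurable_or/mQ/measurable_not.
apply/seteqP; split=> x /=; last by case.
by move=> PQ; have [Px|] := pselect (P x); [right; exact: PQ|left].
Qed.

Lemma measurable_forall (U : Type) (P : U -> T -> Prop) : countable [set: U] ->
  (forall i, measurable [set x | P i x]) -> measurable [set x | forall i, P i x].
Proof.
move=> cU mP; rewrite (_ : [set x | _] = [set x | ~ exists i, ~ P i x]).
  by apply/measurable_not/measurable_exists => // i; exact: measurable_not.
apply/seteqP; split=> x /= Px; first by move=> [i]; apply.
by move=> i; apply: contrapT => nP; apply: Px; exists i.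
Qed.

Local Open Scope ring_scope.

(** Pointwise, the distance from [f] to [g] is at most [e] plus [M + M] times the indicator of
    [E]. *)
Lemma Rintegral_close (R : realType) (mu : probability T R) (f g : T -> R)
    (E : set T) (M e : R) : measurable_fun setT f -> measurable_fun setT g ->
  (forall x, `|f x| <= M) -> (forall x, `|g x| <= M) -> measurable E -> 0 <= e ->
  (forall x, ~ E x -> `|f x - g x| <= e) ->
  `|\int[mu]_x f x - \int[mu]_x g x| <= e + (M + M) * fine (mu E).
Proof.
move=> mf mg fM gM mE e0 fge.
have bint (h : T -> R) K : measurable_fun setT h -> (forall x, `|h x| <= K) ->
    mu.-integrable setT (EFin \o h).
  move=> mh hK; apply: measurable_bounded_integrable => //.
    by rewrite (le_lt_trans (probability_le1 _ _)) ?ltry.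
  exists K; split; first exact: num_real.
  by move=> y Ky x _; apply: le_trans (hK x) _; exact: ltW.
have fi := bint f M mf fM; have gi := bint g M mg gM.
rewrite -RintegralB // (le_trans (le_normr_Rintegral _ _)) //.
  by apply: (bint _ (M + M)) => [|x]; [exact: measurable_funB|
    rewrite (le_trans (ler_normB _ _)) // lerD].
have mI : measurable_fun [set: T] (\1_E : T -> R) by exact: measurable_indic.
have ii : mu.-integrable setT (EFin \o (\1_E : T -> R)).
  apply: (bint _ 1) => // x; rewrite indicE.
  by case: (x \in E); rewrite ?normr1 ?normr0.
have ci : mu.-integrable setT (EFin \o (fun=> e) : T -> \bar R).
  by apply: (bint _ e) => // x; rewrite ger0_norm.
have zi : mu.-integrable setT (EFin \o (fun x => (M + M) * (\1_E x : R))).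
  exact: (integrableZl measurableT (M + M) ii).
rewrite (le_trans (@le_Rintegral _ _ _ mu _ _ (fun x => e + (M + M) * \1_E x) _ _ _ _)) //.
- apply: (bint _ (M + M)) => [|x].
    by apply/measurableT_comp => //; exact: measurable_funB.
  by rewrite normr_id (le_trans (ler_normB _ _)) // lerD.
- exact: (integrableD measurableT ci zi).
- move=> x _; rewrite indicE; have [Ex|nEx] := pselect (E x).
    rewrite mem_set // mulr1 (le_trans (ler_normB _ _)) //.
    by rewrite ler_wpDl // lerD.
  by rewrite memNset // mulr0 addr0; exact: fge.
rewrite RintegralD // Rintegral_cst //.
have mT : fine (mu setT) = 1 by rewrite probability_setT.
rewrite [X in e * X]mT mulr1 RintegralZl //.
by rewrite /Rintegral integral_indic // setIT.
Qed.

End MeasurableEvents.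

Section BorelSubgroups.
Variable G : groupType.
Hypothesis G_countable : countable [set: G].
Local Open Scope classical_set_scope.
Implicit Types (A : set G) (x : G).

Lemma open_measurable_Sub (U : set (Subgroup G)) : open U ->
  measurable (U : set (BorelSub G)).
Proof. by move=> oU; exact: sub_sigma_algebra. Qed.

Lemma measurable_mem x : measurable [set H : BorelSub G | sub_set H x].
Proof. exact: (open_measurable_Sub (open_mem x true)). Qed.

Lemma measurable_virtually_contains d (T : measurableType d) (L : T -> set G) A :
  (forall x, measurable [set t | L t x]) ->
  measurable [set t | virtually_contains (L t) A].
Proof.
move=> mL; apply: measurable_exists => [|s]; first exact: countable_seq.
apply: measurable_forall => // a; apply: measurable_imply.
  exact: measurable_const.
rewrite (_ : [set t | _] = [set t | exists x, x \in s /\ L t (x^-1 * a)%g]).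
  apply: measurable_exists => // x; apply: measurable_and => //.
  exact: measurable_const.
by apply/seteqP; split=> H [x]; [exists x|case; exists x].
Qed.

(** As the group is countable, an open set is a countable union of cylinders, each coded by a finite
    list of elements with prescribed membership. *)
Lemma measurable_to_Sub d (T : measurableType d) (f : T -> BorelSub G) :
  (forall x, measurable [set t | sub_set (f t) x]) -> measurable_fun setT f.
Proof.
have mB : @measurable _ (BorelSub G) = <<s @open (Subgroup G) >> by [].
move=> mf; apply: (measurability _ mB).
move=> _ [U oU <-]; rewrite setTI.
rewrite (_ : _ @^-1` _ = [set t | exists s : seq (G * bool),
    (forall K, (forall p, p \in s -> sub_set K p.1 <-> p.2) -> U K) /\
    (forall p, p \in s -> sub_set (f t) p.1 <-> p.2)]).
  apply: measurable_exists => [|s].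
    by apply: countable_seq; rewrite -setXTT; apply: countableX => //; exact: countableP.
  apply: measurable_and; first exact: measurable_const.
  apply: measurable_forall => [|p].
    by rewrite -setXTT; apply: countableX => //; exact: countableP.
  apply: measurable_imply; first exact: measurable_const.
  apply: measurable_and; apply: measurable_imply => //; exact: measurable_const.
apply/seteqP; split=> t /=; last by case=> s [sU ts]; exact: sU.
move=> Uft; have [s Hs] := nbhs_cylinder (open_nbhs_nbhs (conj oU Uft)).
exists [seq (x, `[< sub_set (f t) x >]) | x <- s]; split=> [K sK|p].
  apply: Hs => x xs; have /= := sK _ (map_f _ xs).
  by move=> -[a b]; split=> [/a/asboolP//|Hx]; apply: b; exact/asboolP.
by move=> /mapP[x xs ->] /=; split=> [?|/asboolP//]; exact/asboolP.
Qed.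

Variables (R : realType) (mu : probability (BorelSub G) R).
Local Open Scope ring_scope.

Lemma continuous_measurable (f : Subgroup G -> R) : continuous f ->
  measurable_fun [set: BorelSub G] f.
Proof.
move=> /continuousP cf; apply: (measurability _ (RGenOpens.measurableE R)).
move=> _ [_ [a [b ->] <-]]; rewrite setTI; apply: open_measurable_Sub.
exact/cf/interval_open.
Qed.

(** Up to [e / 2], a continuous [f] depends on finitely many memberships, and by a union bound the
    event that [Phi n] changes one of them has measure tending to 0. *)
Lemma weak_star_cvg_distribution (Phi : nat -> {mfun BorelSub G >-> BorelSub G}) :
  (forall x, (fun n => fine (mu [set H | ~ (sub_set (Phi n H) x <-> sub_set H x)]))
     @ \oo --> (0 : R)) ->
  weak_star_cvg (fun n => distribution mu (Phi n)) mu.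
Proof.
move=> PhiH f cf; have [M fM] := continuous_bounded cf.
have mf := continuous_measurable cf.
have M0 : 0 <= M by rewrite (le_trans _ (fM (trivial_sub G))).
pose E (s : seq G) n : set (BorelSub G) :=
  [set H | ~ (forall x, x \in s -> sub_set (Phi n H) x <-> sub_set H x)].
have mPhi n x : measurable [set H : BorelSub G | sub_set (Phi n H) x].
  exact: measurable_funPTI (measurable_mem x).
have mEx n x : measurable [set H : BorelSub G |
    ~ (sub_set (Phi n H) x <-> sub_set H x)].
  apply: measurable_not; apply: measurable_and; apply: measurable_imply => //;
    exact: measurable_mem.
have mE s n : measurable (E s n).
  apply: measurable_not; apply: measurable_forall => // x; apply: measurable_imply.
    exact: measurable_const.
  by apply: measurable_and; apply: measurable_imply => //; exact: measurable_mem.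
have E0 s : (fun n => fine (mu (E s n))) @ \oo --> (0 : R).
  elim: s => [|x s IHs].
    rewrite (_ : (fun n => _) = fun=> 0); first exact: cvg_cst.
    apply/funext => n; rewrite (_ : E _ _ = set0) ?measure0 //.
    by apply/seteqP; split=> // H []; move=> y.
  pose B n : set (BorelSub G) := [set H | ~ (sub_set (Phi n H) x <-> sub_set H x)].
  have BE0 : (fun n => fine (mu (B n)) + fine (mu (E s n))) @ \oo --> (0 : R).
    by rewrite -[0 : R]addr0; exact: cvgD (PhiH x) IHs.
  apply: (squeeze_cvgr _ (cvg_cst 0) BE0); apply: nearW => n /=.
  have mB : measurable (B n) by exact: mEx.
  have mEn : measurable (E s n) by exact: mE.
  have mExs : measurable (E (x :: s) n) by exact: mE.
  rewrite fine_ge0 //= -fineD ?fin_num_measure //.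
  rewrite fine_le ?fin_numD ?fin_num_measure //.
  apply: (le_trans _ (measureU2 _ mB mEn)).
  apply: le_measure; rewrite ?inE //; first exact: measurableU.
  move=> H /= nxs.
  have [Hx|] := pselect (sub_set (Phi n H) x <-> sub_set H x); last by left.
  right=> Hs; apply: nxs => y; rewrite inE => /orP[/eqP->//|]; exact: Hs.
apply/cvgrPdist_le => e e0; have e20 : 0 < e / 2 by rewrite divr_gt0.
(* The summand 1 keeps the denominator positive when [M] is 0. *)
have M21 : 0 < M + M + 1 by rewrite ltr_wpDl // addr_ge0.
have [s Hs] := continuous_modulus cf e20.
have /cvgr0_norm_lt/(_ _ (divr_gt0 e20 M21)) := E0 s.
apply: filterS => n; rewrite ger0_norm ?fine_ge0 // => muE.
have -> : \int[distribution mu (Phi n)]_(H in [set: BorelSub G]) f H =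
    \int[mu]_(H in [set: BorelSub G]) (f (Phi n H)).
  rewrite /Rintegral integral_pushforward //.
    exact/measurable_EFinP.
  rewrite preimage_setT; apply: measurable_bounded_integrable => //.
  - by apply: (le_lt_trans (probability_le1 mu _)); [exact: measurableT|exact: ltry].
  - apply: measurableT_comp mf _; exact: measurable_funPT.
  exists M; split; first exact: num_real.
  by move=> y My H _; apply: le_trans (fM _) _; exact: ltW.
have := @Rintegral_close _ _ R mu f (fun H => f (Phi n H)) (E s n) M (e / 2) mf.
move=> /(_ _ fM _ (mE s n) (ltW e20) _) H.
apply: le_trans (H _ _ _) _.
- exact: measurableT_comp.
- by move=> K; exact: fM.
- move=> K /contrapT KE; rewrite distrC ltW //; apply: Hs => x xs.
  by have [? ?] := KE x xs; split.
rewrite [leRHS]splitr lerD2l.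
rewrite (le_trans (ler_wpM2l _ (ltW muE))) ?addr_ge0 //.
by rewrite mulrCA ler_piMr ?ltW // ltr_pdivrMr // mul1r ltrDl.
Qed.

End BorelSubgroups.

(** * Recurrence *)

Section Spread.
Variable G : groupType.
Local Open Scope classical_set_scope.
Local Open Scope group_scope.

(** For a subgroup [L], the entries of the list lie in pairwise distinct left cosets. *)
Fixpoint spread (L : set G) (s : seq G) : Prop :=
  if s is x :: s' then (forall y, y \in s' -> ~ L (y^-1 * x)) /\ spread L s'
  else True.

Lemma spread_exists (L A : set G) k : ~ virtually_contains L A ->
  exists s, [/\ size s = k, forall x, x \in s -> A x & spread L s].
Proof.
move=> nL; elim: k => [|k [s [sk sA sL]]]; first by exists [::].
have [x [Ax xL]] : exists x, A x /\ forall y, y \in s -> ~ L (y^-1 * x).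
  apply: contrapT => /forallNP nx; apply: nL; exists s => a Aa.
  apply: contrapT => /forall2NP nax; apply: (nx a); split=> // y ys Ly.
  by have [] := nax y.
exists (x :: s); split; rewrite /= ?sk // => y.
by rewrite inE => /orP[/eqP->//|/sA].
Qed.

Lemma conj_subK (H : Subgroup G) x : conj_sub (conj_sub H x) x^-1 = H.
Proof.
apply: sub_set_inj; apply/seteqP.
by split=> g; rewrite !sub_set_conj invgK conjgK.
Qed.

End Spread.

Section Recurrence.
Variables (G : groupType) (d : nat -> nat) (rho : {multiplicative G -> Aut d}).
Variables (R : realType) (mu : probability (BorelSub G) R).
Hypotheses (G_countable : countable [set: G]) (faithful : injective rho).
Hypothesis mu_IRS : is_IRS mu.
Variables (gamma : G) (u : vertex d).
Hypothesis gamma_u : rho gamma u <> u.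
Local Open Scope classical_set_scope.
Local Open Scope group_scope.
Implicit Types (H : BorelSub G) (s : seq G).

(* The random subgroup of the recurrence argument: the [x] in [Rist u] with
   [gamma ^ x^-1] in [H] all lie in one of its left cosets. *)
Definition return_differences H : set G :=
  [set a | Rist rho u a /\ exists2 b, Rist rho u b & sub_set H (a ^ gamma * b)].

Lemma Rist_gamma_commute a b : Rist rho u a -> Rist rho u b ->
  commute (a ^ gamma) b.
Proof.
move=> ua ub; apply: (Rist_commute faithful _ _ (Rist_conj ua) ub).
  exact: act_len.
exact/eqP.
Qed.

(** With [c = x^-1 * y], the quotient of the two conjugates of [gamma] is [x * c ^ gamma * y^-1].
    Since [gamma] moves [u], the factor [c ^ gamma] commutes with [x], which leaves
    [b = x * y^-1]. *)
Lemma return_differencesP H x y : Rist rho u x -> Rist rho u y ->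
  sub_set H (gamma ^ x^-1) -> sub_set H (gamma ^ y^-1) ->
  return_differences H (x^-1 * y).
Proof.
move=> ux uy Hx Hy; have sR := Rist_subgroup rho u.
have uxy : Rist rho u (x^-1 * y) by exact: sR.2.
split=> //; exists (x * y^-1).
  by apply: (subgroupM sR ux); exact: (subgroupV sR).
have := (sub_set_subgroup H).2 _ _ Hx Hy; congr (sub_set H _).
rewrite (mulgA _ x) (Rist_gamma_commute uxy ux) !conjgE !invgK !invgM !invgK.
by rewrite !mulgA.
Qed.

(** Conjugation by [Rist u] affects only the factor [b], the other one being supported on a
    different subtree. This makes the events built from [return_differences] invariant under
    [Rist u]. *)
Lemma return_differences_conj H a : Rist rho u a ->
  return_differences (conj_sub H a) = return_differences H.
Proof.
have sub K x : Rist rho u x ->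
    return_differences (conj_sub K x) `<=` return_differences K.
  move=> ux c [uc [b ub Hb]]; split=> //; exists (b ^ x^-1).
    by apply: Rist_conj_fix => //; rewrite -{1}(Rist_fix ux) actK.
  move: Hb; rewrite sub_set_conj conjMg; congr (sub_set K (_ * _)).
  apply/conjg_fixP/commgP/Rist_gamma_commute => //.
  exact: (subgroupV (Rist_subgroup rho u)).
move=> ua; apply/seteqP; split; first exact: sub.
rewrite -{1}(conj_subK H a); apply: sub.
exact: (subgroupV (Rist_subgroup rho u)).
Qed.

Lemma measurable_return_differences a :
  measurable [set H : BorelSub G | return_differences H a].
Proof.
apply: measurable_and; first exact: measurable_const.
rewrite (_ : [set H | _] = [set H : BorelSub G |
    exists b, Rist rho u b /\ sub_set H (a ^ gamma * b)]).
  apply: measurable_exists => // b; apply: measurable_and.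
    exact: measurable_const.
  exact: measurable_mem.
by apply/seteqP; split=> H [b]; [exists b|case; exists b].
Qed.

Lemma measurable_spread s :
  measurable [set H : BorelSub G | spread (return_differences H) s].
Proof.
elim: s => [|x s IHs] /=; first exact: measurable_const.
apply: measurable_and => //; apply: measurable_forall => // y.
apply: measurable_imply; first exact: measurable_const.
by apply: measurable_not; exact: measurable_return_differences.
Qed.

Local Open Scope ereal_scope.

Let E : set (BorelSub G) := [set H | sub_set H gamma].

(** The events for different entries of [s] are disjoint inside [C], because two of them together
    would produce a forbidden return difference. By invariance each has the measure of [E]&[C]. *)
Lemma measure_spread s (C : set (BorelSub G)) : measurable C ->
  (forall x H, Rist rho u x -> C (conj_sub H x) <-> C H) ->
  (forall x, x \in s -> Rist rho u x) ->
  (forall H, C H -> spread (return_differences H) s) ->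
  mu [set H | (exists2 x, x \in s & sub_set H (gamma ^ x^-1)) /\ C H] =
    (size s)%:R%:E * mu (E `&` C).
Proof.
move=> mC CR; elim: s => [_ _|x s IHs uxs Cs].
  rewrite mul0e (_ : [set H | _] = set0) ?measure0 //.
  by apply/seteqP; split=> // H [[]].
pose U (t : seq G) : set (BorelSub G) :=
  [set H | (exists2 x, x \in t & sub_set H (gamma ^ x^-1)) /\ C H].
pose Ex : set (BorelSub G) := [set H | sub_set H (gamma ^ x^-1) /\ C H].
have mE : measurable (E `&` C) by apply: measurableI => //; exact: measurable_mem.
have mEx : measurable Ex by apply: measurable_and => //; exact: measurable_mem.
have mU t : measurable (U t).
  apply: measurable_and => //.
  rewrite (_ : [set H | _] = [set H : BorelSub G |
      exists y, y \in t /\ sub_set H (gamma ^ y^-1)]).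
    apply: measurable_exists => // y; apply: measurable_and.
      exact: measurable_const.
    exact: measurable_mem.
  by apply/seteqP; split=> H [y]; [exists y|case; exists y].
have us y : y \in s -> Rist rho u y by move=> ys; apply: uxs; rewrite inE ys orbT.
have ux : Rist rho u x by apply: uxs; rewrite inE eqxx.
rewrite -/(U (x :: s)) (_ : U (x :: s) = Ex `|` U s); last first.
  apply/seteqP; split=> H.
    move=> [[y]]; rewrite inE => /orP[/eqP->|ys] Hy CH; first by left.
    by right; split=> //; exists y.
  move=> [[Hx CH]|[[y ys Hy] CH]]; split=> //.
    by exists x; rewrite ?inE ?eqxx.
  by exists y; rewrite ?inE ?ys ?orbT.
transitivity (mu Ex + mu (U s)).
  rewrite measureU //; apply/seteqP; split=> // H [[Hx CH] [[y ys Hy] _]].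
  have [/(_ y ys) + _] := Cs H CH; apply.
  exact: return_differencesP (us y ys) ux Hy Hx.
have -> : mu Ex = mu (E `&` C).
  rewrite -(mu_IRS x mE); congr (mu _).
  by apply/seteqP; split=> H [Hx]; rewrite /= CR.
rewrite IHs //; last by move=> H /Cs[].
rewrite /= -addn1 natrD EFinD ge0_muleDl ?lee_fin // mul1e; exact: addeC.
Qed.

Lemma measurable_not_virtually_return :
  measurable [set H : BorelSub G | sub_set H gamma /\
    ~ virtually_contains (return_differences H) (Rist rho u)].
Proof.
apply: measurable_and; first exact: measurable_mem.
apply: measurable_not; apply: measurable_virtually_contains => //.
exact: measurable_return_differences.
Qed.

(** On the bad event there is a spread list of length [k] in [Rist u]. Cutting according to the
    first such list in an enumeration gives disjoint invariant pieces, and [measure_spread] bounds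
    [k] times the mass of [E] in each piece by the mass of the piece. *)
Lemma measure_not_virtually_return_le k :
  k%:R%:E * mu [set H : BorelSub G | sub_set H gamma /\
    ~ virtually_contains (return_differences H) (Rist rho u)] <= 1.
Proof.
set Bad := (X in mu X).
have /countable_injP[phi phi_inj] := countable_seq G_countable.
pose P n s := [/\ phi s = n, size s = k & forall x, x \in s -> Rist rho u x].
(* [F n] is the event that the list with code [n] is spread; [seqDU F n] adds that no list with a
   smaller code is. *)
pose F n : set (BorelSub G) :=
  [set H | exists s, P n s /\ spread (return_differences H) s].
have mF n : measurable (F n).
  apply: measurable_exists => [|s]; first exact: countable_seq.
  apply: measurable_and; first exact: measurable_const.
  exact: measurable_spread.
have mD n : measurable (seqDU F n) by exact: seqDU_measurable.
have FR n x H : Rist rho u x -> F n (conj_sub H x) <-> F n H.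
  by move=> ux; rewrite /F /= return_differences_conj.
have DR n x H : Rist rho u x -> seqDU F n (conj_sub H x) <-> seqDU F n H.
  move=> ux; rewrite /seqDU -bigcup_mkord; split=> -[FH nF].
    by split=> [|[m mn FmH]]; [exact/(FR n x)|apply: nF; exists m => //; exact/FR].
  by split=> [|[m mn /FR FmH]]; [exact/FR|apply: nF; exists m => //; exact: FmH].
have leD n : k%:R%:E * mu (E `&` seqDU F n) <= mu (seqDU F n).
  have [[s [phis sk us]]|nP] := pselect (exists s, P n s).
    rewrite -sk -measure_spread //; last 2 first.
    - by move=> x H; exact: DR.
    - move=> H DH; have [t [[phit _ _]]] : F n H by exact: subset_seqDU DH.
      by rewrite (_ : t = s) //; apply: phi_inj; rewrite ?in_setT // phit phis.
    apply: le_measure; rewrite ?inE //; last by move=> H [].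
    apply: measurable_and; last exact: mD.
    rewrite (_ : [set H | _] = [set H : BorelSub G |
        exists y, y \in s /\ sub_set H (gamma ^ y^-1)]).
      apply: measurable_exists => // y; apply: measurable_and.
        exact: measurable_const.
      exact: measurable_mem.
    by apply/seteqP; split=> H [y]; [exists y|case; exists y].
  suff -> : seqDU F n = set0 by rewrite setI0 measure0 mule0.
  apply/seteqP; split=> // H DH; have [s [Ps _]] : F n H by exact: subset_seqDU DH.
  by apply: nP; exists s.
have mE : measurable E by exact: measurable_mem.
have BadF : Bad `<=` \bigcup_n (E `&` seqDU F n).
  move=> H [Hg /(spread_exists k)[s [sk us sH]]].
  rewrite -setI_bigcupr -seqDU_bigcup_eq; split=> //.
  by exists (phi s) => //; exists s; split.
have mU : measurable (\bigcup_n (E `&` seqDU F n)).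
  by apply: bigcupT_measurable => n; exact: measurableI.
apply: (@le_trans _ _ (k%:R%:E * mu (\bigcup_n (E `&` seqDU F n)))).
  apply: lee_wpmul2l; first by rewrite lee_fin.
  by apply: le_measure; rewrite ?inE //; exact: measurable_not_virtually_return.
have tD := @trivIset_seqDU _ F.
rewrite measure_semi_bigcup //; last 2 first.
- by move=> n; exact: measurableI.
- by move=> i j _ _ [H [[_ Hi] [_ Hj]]]; apply: tD => //; exists H.
rewrite -nneseriesZl //.
apply: (@le_trans _ _ (\sum_(n <oo) mu (seqDU F n))).
  by apply: lee_nneseries => [n _ _|n _]; [rewrite mule_ge0 ?lee_fin|exact: leD].
rewrite -measure_semi_bigcup //; last by exact: bigcupT_measurable.
by apply: probability_le1; exact: bigcupT_measurable.
Qed.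

Lemma measure_not_virtually_return :
  mu [set H : BorelSub G | sub_set H gamma /\
    ~ virtually_contains (return_differences H) (Rist rho u)] = 0.
Proof.
have := measure_not_virtually_return_le.
set Bad := (X in mu X) => leB.
have finB : mu Bad \is a fin_num.
  by rewrite fin_num_measure //; exact: measurable_not_virtually_return.
apply/eqP; rewrite eq_le measure_ge0 andbT -(fineK finB) lee_fin.
rewrite leNgt; apply/negP => B0.
have := leB (Num.truncn (fine (mu Bad))^-1).+1.
rewrite -(fineK finB) -EFinM lee_fin leNgt => /negP; apply.
rewrite -ltr_pdivrMr // div1r.
exact: truncnS_gt.
Qed.

End Recurrence.

Section AlmostSure.
Variables (G : groupType) (d : nat -> nat) (rho : {multiplicative G -> Aut d}).
Variables (R : realType) (mu : probability (BorelSub G) R).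
Hypotheses (G_countable : countable [set: G]) (faithful : injective rho).
Hypothesis mu_IRS : is_IRS mu.
Local Open Scope classical_set_scope.
Local Open Scope group_scope.

Lemma negligible_exists d' (T : measurableType d') (nu : probability T R)
    (U : Type) (P : U -> T -> Prop) : countable [set: U] ->
  (forall i, nu.-negligible [set x | P i x]) ->
  nu.-negligible [set x | exists i, P i x].
Proof.
move=> /countable_injP[phi phi_inj] nP.
apply: (@negligibleS _ _ _ _
    (\bigcup_n [set x | exists i, phi i = n /\ P i x])).
  by move=> x [i Pi]; exists (phi i) => //; exists i.
apply: negligible_bigcup => n.
have [[i phii]|nphi] := pselect (exists i, phi i = n); last first.
  apply: (negligibleS _ (negligible_set0 nu)) => x [i [phii _]].
  by apply: nphi; exists i.
apply: (negligibleS _ (nP i)) => x [j [phij Pj]] /=.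
by rewrite (_ : i = j) //; apply: phi_inj; rewrite ?in_setT // phii.
Qed.

Lemma ae_virtually_contains_projection :
  mu.-negligible [set H : BorelSub G | exists p : G * vertex d,
    sub_set H p.1 /\ rho p.1 p.2 <> p.2 /\
    ~ virtually_contains (rist_projection rho (sub_set H) p.2 (rho p.1 p.2))
      (Rist rho p.2)].
Proof.
apply: negligible_exists => [|[g u]] /=.
  by rewrite -setXTT; apply: countableX => //; exact: countableP.
have [gu|gu] := pselect (rho g u = u).
  by apply: (negligibleS _ (negligible_set0 mu)) => H [_ []].
(* Recurrence is applied to [g^-1]: conjugating [a ^ g^-1 * b] by [g], which lies in [H], gives
   [a * b ^ g] with [b ^ g] supported below the image of [u]. *)
have gVu : rho g^-1 u <> u by move=> e; apply: gu; rewrite -{1}e actKV.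
have /(negligibleP mu (measurable_not_virtually_return rho G_countable _ _)) :=
  measure_not_virtually_return G_countable faithful mu_IRS gVu.
apply: negligibleS => H [Hg [_ nv]]; split.
  exact: (subgroupV (sub_set_subgroup H)).
move=> vr; apply: nv; apply: (virtually_contains_sub _ _ vr) => // a [ua [b ub Hab]].
split=> //; exists (b ^ g); first exact: Rist_conj.
have HV := subgroupV (sub_set_subgroup H) Hg.
have := subgroupM (sub_set_subgroup H) HV (subgroupM (sub_set_subgroup H) Hab Hg).
by congr (sub_set H _); rewrite !conjgE invgK !mulgA mulVg mul1g.
Qed.

End AlmostSure.

(** * Random approximants *)

Section Approximants.
Variables (G : groupType) (d : nat -> nat) (rho : {multiplicative G -> Aut d}).
Variables (R : realType) (mu : probability (BorelSub G) R).
Hypotheses (G_countable : countable [set: G]) (faithful : injective rho).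
Hypotheses (d_ge2 : forall i, 2 <= d i) (branch : is_branch rho).
Hypothesis mu_IRS : is_IRS mu.
Local Open Scope classical_set_scope.
Local Open Scope group_scope.
Implicit Types (H : BorelSub G) (u v w : vertex d).

Definition thin H : set (vertex d) :=
  [set v | ~ virtually_contains (sub_set H) (Rist rho v)].

Lemma thin_conj H x v : thin (conj_sub H x) (rho x v) <-> thin H v.
Proof.
have vx K y u : virtually_contains (sub_set K) (Rist rho u) ->
    virtually_contains (sub_set (conj_sub K y)) (Rist rho (rho y u)).
  move=> /(virtually_contains_conj y^-1 (sub_set_subgroup K)).
  apply: virtually_contains_sub => // g /(@Rist_conj _ _ _ _ _ y^-1).
  by rewrite actK.
split; apply: contra_not; first exact: vx.
by move=> /(vx _ x^-1); rewrite conj_subK actK.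
Qed.

Lemma thin_below H v w : below v w -> thin H w -> thin H v.
Proof.
move=> vw; apply: contra_not => vH; apply: (virtually_contains_sub _ _ vH) => // g.
exact: Rist_below.
Qed.

Lemma measurable_thin v : measurable [set H : BorelSub G | thin H v].
Proof.
apply: measurable_not; apply: measurable_virtually_contains => // x.
exact: measurable_mem.
Qed.

Section Approximant.
Variables n c : nat.

Definition approximant H : BorelSub G :=
  subgroup_of (approximation_subgroup rho (thin H) (leq_addr c n)
    (sub_set_subgroup H)).

Lemma sub_set_approximant H : sub_set (approximant H) =
  approximation rho (thin H) n (n + c) (sub_set H).
Proof. exact: sub_set_of. Qed.

Lemma approximant_conj H x : approximant (conj_sub H x) = conj_sub (approximant H) x.
Proof.
have sub K y g : sub_set (approximant K) g ->
    sub_set (approximant (conj_sub K y)) (g ^ y).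
  rewrite !sub_set_approximant => /(approximation_conj y).
  congr (approximation _ _ _ _ _ _); apply/seteqP; split=> v /=.
    by rewrite -(thin_conj K y) actKV.
  by rewrite -(thin_conj K y (rho y^-1 v)) actKV.
apply: sub_set_inj; apply/seteqP; split=> g; rewrite sub_set_conj.
  by move=> /(sub _ x^-1); rewrite conj_subK.
by move=> /(sub _ x); rewrite conjgKV.
Qed.

Lemma measurable_approximant : measurable_fun [set: BorelSub G] approximant.
Proof.
apply: (measurable_to_Sub G_countable) => g.
rewrite (_ : [set H | _] = [set H : BorelSub G | exists h, sub_set H h /\
   forall v, len v = n ->
    thin H v /\ (forall w, below v w -> rho h w = w /\ (len w <= n + c -> rho g w = w)) \/
    ~ thin H v /\ (forall w, below v w -> rho g w = rho h w)]).
  apply: measurable_exists => // h; apply: measurable_and; first exact: measurable_mem.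
  apply: measurable_forall => [|v]; first exact: countableP.
  apply: measurable_imply; first exact: measurable_const.
  apply: measurable_or; apply: measurable_and; try exact: measurable_const.
    exact: measurable_thin.
  by apply: measurable_not; exact: measurable_thin.
apply/seteqP; split=> H; rewrite /= sub_set_approximant.
  by case=> h; exists h.
by case=> h [Hh gh]; exists h.
Qed.

HB.instance Definition _ := isMeasurableFun.Build _ _ _ _ approximant
  measurable_approximant.

Lemma approximant_IRS : is_IRS (distribution mu approximant).
Proof.
move=> g A mA; rewrite /distribution /pushforward.
have mB : measurable (approximant @^-1` A).
  by rewrite -[X in measurable X]setTI; exact: measurable_approximant.
rewrite -[RHS](mu_IRS g mB); congr (mu _).
by apply/seteqP; split=> H /=; rewrite approximant_conj.
Qed.

Lemma approximant_finite_index :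
  supported_on_finite_index (distribution mu approximant).
Proof.
(* The exceptional event is phrased with [virtually_contains], which is measurable; its preimage
   under the approximant is empty. *)
exists [set H | ~ virtually_contains (sub_set H) [set: G]]; split.
- apply: measurable_not; apply: measurable_virtually_contains => // x.
  exact: measurable_mem.
- rewrite /= /distribution /pushforward (_ : _ @^-1` _ = set0) ?measure0 //.
  apply/seteqP; split=> // H; apply.
  rewrite sub_set_approximant; apply: finite_index_virtually.
    by have [] := approximation_subgroup rho (thin H) (leq_addr c n) (sub_set_subgroup H).
  exact: (approximation_finite_index faithful branch (sub_set_subgroup H) (leq_addr _ _)).
move=> H /=; apply: contra_not => /(virtually_finite_index (sub_set_subgroup H)).
by [].
Qed.

End Approximant.

(** These vertices form a ray, which makes [thin_prob] monotone. By transitivity and invariance of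
    [mu] each of them represents its whole level. *)
Definition zero_vertex n : vertex d :=
  exist (is_word d) (nseq n 0) (is_word_nseq0 d_ge2 n).

Definition thin_prob n : R := fine (mu [set H | thin H (zero_vertex n)]).

Local Open Scope ereal_scope.

Lemma thin_probE v : mu [set H | thin H v] = (thin_prob (len v))%:E.
Proof.
rewrite fineK ?fin_num_measure //; last exact: measurable_thin.
have [tr _ _] := branch; have [|x <-] := tr v (zero_vertex (len v)).
  by rewrite /len /= size_nseq.
rewrite -[RHS](mu_IRS x (measurable_thin (rho x v))); congr (mu _).
by apply/seteqP; split=> H; rewrite /= thin_conj.
Qed.

Lemma thin_probB v w : below v w ->
  mu [set H | thin H v /\ ~ thin H w] = (thin_prob (len v) - thin_prob (len w))%:E.
Proof.
move=> vw; have mv := measurable_thin v; have mw := measurable_thin w.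
rewrite EFinB -!thin_probE.
have <- : [set H | thin H v] `&` [set H | thin H w] = [set H | thin H w].
  by apply/setIidr => H; exact: thin_below.
apply: measureD => //; rewrite (le_lt_trans (probability_le1 _ _)) ?ltry //.
Qed.

Lemma thin_prob_nonincreasing : nonincreasing_seq thin_prob.
Proof.
move=> m n mn; have zmn : below (zero_vertex m) (zero_vertex n).
  by rewrite /below prefixE /= take_nseq // size_nseq.
have : 0 <= mu [set H | thin H (zero_vertex m) /\ ~ thin H (zero_vertex n)] by [].
by rewrite thin_probB // lee_fin /len /= !size_nseq subr_ge0.
Qed.

(** A nonincreasing sequence of nonnegative numbers converges, so it has the same limit as its shift
    by [c]. *)
Lemma thin_prob_gap c :
  (fun n => (thin_prob n - thin_prob (n + c))%R) @ \oo --> (0 : R)%R.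
Proof.
have cv : cvgn thin_prob.
  apply: nonincreasing_is_cvgn; first exact: thin_prob_nonincreasing.
  by exists 0%R => _ [n _ <-]; rewrite fine_ge0.
rewrite -(subrr (limn thin_prob)); apply: cvgB => //.
by rewrite cvg_shiftn.
Qed.

Lemma measure_exists_le (I : eqType) (s : seq I) (P : I -> BorelSub G -> Prop) (e : R) :
  (forall i, i \in s -> measurable [set H | P i H]) ->
  (forall i, i \in s -> mu [set H | P i H] <= e%:E) ->
  mu [set H | exists2 i, i \in s & P i H] <= ((size s)%:R * e)%:E.
Proof.
elim: s => [_ _|i s IHs mP Pe].
  rewrite mul0r (_ : [set H | _] = set0) ?measure0 //.
  by apply/seteqP; split=> // H [].
have ms j : j \in s -> j \in i :: s by move=> js; rewrite inE js orbT.
have mPs : measurable [set H : BorelSub G | exists2 j, j \in s & P j H].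
  rewrite (_ : [set H | _] = \bigcup_(j in [set` s]) [set H | P j H]) //.
  by apply: fin_bigcup_measurable => [|j /ms/mP]; first exact: finite_seq.
have -> : [set H | exists2 j, j \in i :: s & P j H] =
    [set H | P i H] `|` [set H | exists2 j, j \in s & P j H].
  apply/seteqP; split=> H.
    by move=> [j]; rewrite inE => /orP[/eqP->|js] Pj; [left|right; exists j].
  by move=> [Pi|[j js Pj]]; [exists i; rewrite ?inE ?eqxx|exists j => //; exact: ms].
have mi := mP i (mem_head _ _).
apply: le_trans (measureU2 _ mi mPs) _.
rewrite /= -addn1 addnC natrD mulrDl mul1r EFinD; apply: leeD.
  by apply: Pe; exact: mem_head.
by apply: IHs => j js; [apply: mP; exact: ms|apply: Pe; exact: ms].
Qed.

Hypothesis G_just_infinite : just_infinite G.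

Lemma approximant_cvg (g : G) (c : nat) : bounded_activity rho g ->
  (exists n0, forall v, n0 <= len v -> autsec (rho g) v <> 1%g ->
    exists w, [/\ below v w, len w <= len v + c & rho g v = v -> rho g w <> w])%N ->
  (fun n => fine (mu [set H | ~ (sub_set (approximant n c H) g <-> sub_set H g)]))
    @ \oo --> (0 : R)%R.
Proof.
move=> [C gC] [n0 Hn0].
have /choice[w Hw] (v : vertex d) : exists w,
    (n0 <= len v)%N -> autsec (rho g) v <> 1%g ->
    [/\ below v w, len w <= len v + c & rho g v = v -> rho g w <> w]%N.
  have [[nv gv]|nP] := pselect ((n0 <= len v)%N /\ autsec (rho g) v <> 1%g).
    by have [w ?] := Hn0 v nv gv; exists w.
  by exists v => nv gv; case: nP.
have [N [mN N0 NP]] := ae_virtually_contains_projection G_countable faithful mu_IRS.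
pose D v : set (BorelSub G) := [set H | thin H v /\ ~ thin H (w v)].
have mD v : measurable (D v).
  apply: measurable_and; first exact: measurable_thin.
  by apply: measurable_not; exact: measurable_thin.
pose bad n := [seq v <- level d n | autsec (rho g) v != 1%g].
have sub n : (n0 <= n)%N ->
    [set H | ~ (sub_set (approximant n c H) g <-> sub_set H g)] `<=`
    N `|` [set H | exists2 v, v \in bad n & D v H].
  move=> nn H /= nH; have [|NH] := pselect (N H); first by left.
  right; apply: contrapT => /forall2NP nD; apply: nH.
  have sH := sub_set_subgroup H.
  (* Off the null set [N], all projections needed by [virtually_contains_moved] have finite index,
     so a moved vertex cannot be thin. *)
  have moved h v : sub_set H h -> thin H v -> rho h v = v.
    move=> Hh tv; apply: contrapT => hv; apply: tv.
    apply: (virtually_contains_moved faithful branch d_ge2 G_just_infinite sH _ Hh hv).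
    move=> k u Hk ku; apply: contrapT => nv; apply: NH; apply: NP.
    by exists (k, u).
  rewrite sub_set_approximant; split.
    apply: approximation_sub => // v lv gv.
    by exists (w v); rewrite -lv; apply: Hw; rewrite ?lv.
  move=> Hg; apply: sub_approximation => // [v _|v lv gv tv].
    exact: moved.
  (* A thin [v] with non-trivial section is fixed by [g], so [g] moves [w v], which is therefore not
     thin: this is the excluded event [D v]. *)
  have [|vw lw mw] := Hw v _ gv; first by rewrite lv.
  have [|] := nD v.
    by apply; rewrite mem_filter mem_level; apply/andP; split; apply/eqP.
  apply; split=> // tw; apply: (mw (moved _ _ Hg tv)).
  exact: moved.
have le n : (n0 <= n)%N ->
    mu [set H | ~ (sub_set (approximant n c H) g <-> sub_set H g)] <=
      (C%:R * (thin_prob n - thin_prob (n + c)))%:E.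
  move=> nn; have gap0 : (0 <= thin_prob n - thin_prob (n + c))%R.
    by rewrite subr_ge0; apply: thin_prob_nonincreasing; exact: leq_addr.
  have badv v : v \in bad n -> len v = n /\ autsec (rho g) v <> 1%g.
    by rewrite mem_filter mem_level => /andP[/eqP gv /eqP lv].
  apply: (@le_trans _ _ (mu [set H | exists2 v, v \in bad n & D v H])).
    have mbad : measurable [set H | exists2 v, v \in bad n & D v H].
      rewrite (_ : [set H | _] = \bigcup_(v in [set` bad n]) D v) //.
      by apply: fin_bigcup_measurable => //; exact: finite_seq.
    apply: (@le_trans _ _ (mu (N `|` [set H | exists2 v, v \in bad n & D v H]))).
      apply: le_measure (sub n nn); rewrite ?inE; last exact: measurableU.
      have mPhi : measurable [set H | sub_set (approximant n c H) g].
        rewrite -[X in measurable X]setTI.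
        exact: (measurable_approximant n c measurableT (measurable_mem g)).
      by apply: measurable_not; apply: measurable_and; apply: measurable_imply => //;
        exact: measurable_mem.
    by rewrite (le_trans (measureU2 _ mN mbad)) // [X in X + _]N0 add0e.
  apply: (le_trans (measure_exists_le (e := (thin_prob n - thin_prob (n + c))%R) _ _)).
  - by move=> v _; exact: mD.
  - move=> v /badv[lv gv]; have [|vw lw _] := Hw v _ gv; first by rewrite lv.
    (* Since [w v] is at most [c] levels below [v], monotonicity bounds the drop by the gap over [c]
       levels. *)
    rewrite thin_probB // lee_fin lv lerD2l lerN2.
    by apply: thin_prob_nonincreasing; rewrite -lv.
  by rewrite lee_fin ler_wpM2r // ler_nat; exact: gC.
have gap0 : (fun n => (C%:R * (thin_prob n - thin_prob (n + c)))%R) @ \oo --> (0 : R)%R.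
  by rewrite -(mulr0 (C%:R : R)%R); apply: cvgMr; exact: thin_prob_gap.
apply: (squeeze_cvgr _ (cvg_cst 0%R) gap0).
exists n0 => // n /= nn; rewrite fine_ge0 //= -lee_fin fineK; first exact: le.
by rewrite ge0_fin_numE // (le_lt_trans (le n nn)) ?ltry.
Qed.

Lemma co_sofic_of_contraction c :
  (forall g, bounded_activity rho g) ->
  (forall g, exists n0, forall v, n0 <= len v -> autsec (rho g) v <> 1%g ->
    exists w, [/\ below v w, len w <= len v + c & rho g v = v -> rho g w <> w])%N ->
  co_sofic mu.
Proof.
move=> bG cG; exists (fun n => distribution mu (approximant n c)); split=> [n|].
  by split; [exact: approximant_IRS|exact: approximant_finite_index].
apply: (@weak_star_cvg_distribution G G_countable R mu
  (fun n => approximant n c : {mfun BorelSub G >-> BorelSub G})) => g.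
exact: approximant_cvg.
Qed.

End Approximants.

Theorem theorem6p6 (R : realType) (G : groupType) (d : nat -> nat)
    (rho : {multiplicative G -> Aut d})
    (G_countable : countable [set: G])
    (d_ge2 : forall i, 2 <= d i)
    (d_bounded : exists D : nat, forall i, d i <= D)
    (faithful : injective rho)
    (transitive : level_transitive rho)
    (G_just_infinite : just_infinite G)
    (G_branch : is_branch rho)
    (contraction : exists N : forall i, set (Aut (iter i shiftd d)),
      (forall g : G, exists n_g : nat, forall v : vertex d,
         n_g <= len v -> N (len v) (autsec (rho g) v)) /\
      (exists c0 i0 : nat, forall i, i0 <= i ->
         forall gamma, N i gamma -> gamma <> 1%g -> trunc c0 gamma <> 1%g))
    (G_bounded : forall g : G, bounded_activity rho g) :
  forall mu : probability (BorelSub G) R, is_IRS mu -> co_sofic mu.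
Proof.
move=> mu mu_IRS; have [N [gN [c0 [i0 Nc]]]] := contraction.
apply: (co_sofic_of_contraction G_countable faithful d_ge2 G_branch mu_IRS
  G_just_infinite (c := c0)) => //.
exact: contraction_moves gN Nc.
Qed.
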